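(* Let $(A,X)$ be a proper $\mathbb N^n$-product system. For an invariant family $K$ put $I_K^F=\bigcap_{G\supset F}K^G$, and for a T-family $I$ put $K_I^F=(X^{\mathbf 1-\mathbf 1_F})^{-1}(I^F)$, for $F\subset[n]$. The maps $K\mapsto I_K$ and $I\mapsto K_I$ are mutually inverse lattice isomorphisms between the set of invariant families and the set of T-families of ideals of $A$.
   Context: Notation: $[n]=\{1,\dots,n\}$, $\mathfrak F$ is the set of all subsets of $[n]$; for $F\in\mathfrak F$, $\mathbf 1_F\in\mathbb N^n$ is its characteristic vector, $\mathbf 1_i=\mathbf 1_{\{i\}}$, $\mathbf 1=\mathbf 1_{[n]}$; $\mathbf 0$ is the zero vector. Ideals are closed and two-sided. An $A$-$A$-correspondence is a right Hilbert $A$-module $X$ with a $*$-homomorphism $\varphi:A\to\mathcal L(X)$, $a\cdot x=\varphi(a)x$. An $\mathbb N^n$-product system $(A,X)$ is a family of $A$-$A$-correspondences $(X^{\mathbf m})_{\mathbf m\in\mathbb N^n}$ with left actions $\varphi^{\mathbf m}$, $X^{\mathbf 0}=A$, and associative isomorphisms of correspondences $X^{\mathbf m}\otimes_AX^{\mathbf k}\to X^{\mathbf m+\mathbf k}$ ($\mathbf m,\mathbf k\ne\mathbf 0$). It is proper if $\varphi^{\mathbf m}(A)\subset\mathcal K(X^{\mathbf m})$ (generalized compact operators) for all $\mathbf m$. For an ideal $J\subset A$: $(X^{\mathbf m})^{-1}(J)=\{a\in A:a\cdot X^{\mathbf m}\subset X^{\mathbf m}J\}$, and $(X^{\mathbf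 0})^{-1}(J)=J$. A family $K=\{K^F\}_{F\in\mathfrak F}$ of ideals of $A$ is an invariant family if $K^G=(X^{\mathbf 1_i})^{-1}(K^G\cap K^{G\cup\{i\}})$ for all $G\in\mathfrak F$, $i\in[n]\setminus G$. A family $I=\{I^F\}_{F\in\mathfrak F}$ of ideals of $A$ is a T-family if $I^F=(X^{\mathbf 1_i})^{-1}(I^F)\cap I^{F\cup\{i\}}$ for all $F\in\mathfrak F$, $i\in[n]\setminus F$. Both sets are ordered by componentwise inclusion ($K_1\preceq K_2$ iff $K_1^F\subset K_2^F$ for all $F$). In $\bigcap_{G\supset F}$, $G$ ranges over all subsets of $[n]$ containing $F$ (including $F$ itself). *)

(* Defs.v *)
From HB Require Import structures.
From mathcomp Require Import all_boot all_order all_algebra.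
From mathcomp Require Import all_classical all_reals all_analysis.
From mathcomp Require Import complex.

Set Implicit Arguments.
Unset Strict Implicit.
Unset Printing Implicit Defensive.

Import Order.TTheory GRing.Theory Num.Theory.
Import numFieldNormedType.Exports.

Local Open Scope classical_set_scope.
Local Open Scope ring_scope.

(* Complex C*-algebras. A unit is not assumed, so the product cannot come from
   the ring structures of ssralg. *)
Record cstar_algebra (R : realType) := CstarAlgebra {
  cs_sort :> completeNormedModType R[i];
  amul : cs_sort -> cs_sort -> cs_sort;
  astar : cs_sort -> cs_sort;
  amulA : forall a b c, amul a (amul b c) = amul (amul a b) c;
  amulDl : forall a b c, amul (a + b) c = amul a c + amul b c;
  amulDr : forall a b c, amul a (b + c) = amul a b + amul a c;
  amulZl : forall (l : R[i]) a b, amul (l *: a) b = l *: amul a b;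
  amulZr : forall (l : R[i]) a b, amul a (l *: b) = l *: amul a b;
  astarK : forall a, astar (astar a) = a;
  astarD : forall a b, astar (a + b) = astar a + astar b;
  astarZ : forall (l : R[i]) a, astar (l *: a) = l^* *: astar a;
  astarM : forall a b, astar (amul a b) = amul (astar b) (astar a);
  norm_amul : forall a b, `|amul a b| <= `|a| * `|b|;
  norm_cstar : forall a, `|amul (astar a) a| = `|a| ^+ 2
}.

Definition apositive (R : realType) (A : cstar_algebra R) (a : A) : Prop :=
  exists b : A, a = amul (astar b) b.

Record is_ideal (R : realType) (A : cstar_algebra R) (J : set A) : Prop := {
  ideal0 : J 0;
  idealD : forall a b, J a -> J b -> J (a + b);
  idealZ : forall (l : R[i]) a, J a -> J (l *: a);
  ideal_mull : forall a b, J b -> J (amul a b);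
  ideal_mulr : forall a b, J a -> J (amul a b);
  ideal_closed : closed J
}.

(* Right Hilbert A-modules. The inner product is linear in its second argument,
   and hm_norm makes the complete norm of the carrier the one it induces. *)
Record hilbert_module (R : realType) (A : cstar_algebra R) := HilbertModule {
  hm_sort :> completeNormedModType R[i];
  hract : hm_sort -> A -> hm_sort;
  inner : hm_sort -> hm_sort -> A;
  ractDl : forall x y a, hract (x + y) a = hract x a + hract y a;
  ractDr : forall x a b, hract x (a + b) = hract x a + hract x b;
  ractZl : forall (l : R[i]) x a, hract (l *: x) a = l *: hract x a;
  ractZr : forall (l : R[i]) x a, hract x (l *: a) = l *: hract x a;
  ractM : forall x a b, hract x (amul a b) = hract (hract x a) b;
  innerD : forall x y z, inner x (y + z) = inner x y + inner x z;
  innerZ : forall (l : R[i]) x y, inner x (l *: y) = l *: inner x y;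
  inner_ract : forall x y a, inner x (hract y a) = amul (inner x y) a;
  inner_star : forall x y, astar (inner x y) = inner y x;
  inner_ge0 : forall x, apositive (inner x x);
  inner_eq0 : forall x, inner x x = 0 -> x = 0;
  hm_norm : forall x, `|x| ^+ 2 = `|inner x x|
}.

Definition adjoint (R : realType) (A : cstar_algebra R)
    (X : hilbert_module A) (T S : X -> X) : Prop :=
  forall x y, inner (T x) y = inner x (S y).

Definition adjointable (R : realType) (A : cstar_algebra R)
    (X : hilbert_module A) (T : X -> X) : Prop :=
  exists S, adjoint T S.

(* Generalized compact operators: the closure, for the operator norm, of the
   span of the operators z |-> x <y, z>. Scalars are absorbed by x. *)
Definition compact_operator (R : realType) (A : cstar_algebra R)
    (X : hilbert_module A) (T : X -> X) : Prop :=
  adjointable T /\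
  forall e : R[i], 0 < e ->
    exists (r : nat) (x y : 'I_r -> X), forall z,
      `|T z - \sum_(i < r) hract (x i) (inner (y i) z)| <= e * `|z|.

(* A-A-correspondences. lact_adj says that the left action takes values in the
   adjointable operators and preserves the involution. *)
Record correspondence (R : realType) (A : cstar_algebra R) := Correspondence {
  corr_module :> hilbert_module A;
  lact : A -> corr_module -> corr_module;
  lactD : forall a b x, lact (a + b) x = lact a x + lact b x;
  lactZ : forall (l : R[i]) a x, lact (l *: a) x = l *: lact a x;
  lactM : forall a b x, lact (amul a b) x = lact a (lact b x);
  lact_adj : forall a, adjoint (lact a) (lact (astar a))
}.

Record corr_iso (R : realType) (A : cstar_algebra R)
    (X Y : correspondence A) := CorrIso {
  iso_fun :> X -> Y;
  iso_bij : bijective iso_fun;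
  isoD : forall x y, iso_fun (x + y) = iso_fun x + iso_fun y;
  isoZ : forall (l : R[i]) x, iso_fun (l *: x) = l *: iso_fun x;
  iso_ract : forall x a, iso_fun (hract x a) = hract (iso_fun x) a;
  iso_lact : forall a x, iso_fun (lact a x) = lact a (iso_fun x);
  iso_inner : forall x y, inner (iso_fun x) (iso_fun y) = inner x y
}.

(* The interior tensor product of X and Y over A: a correspondence with an
   A-balanced bilinear map x, y |-> x (x) y whose range has dense span, with
   <x (x) y, x' (x) y'> = <y, <x, x'> y'>. Being the completion of the balanced
   algebraic tensor product for this inner product, it is determined by these
   properties up to a unique isomorphism. *)
Record tensor_product (R : realType) (A : cstar_algebra R)
    (X Y : correspondence A) := TensorProduct {
  tp_corr :> correspondence A;
  tens : X -> Y -> tp_corr;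
  tensDl : forall x x' y, tens (x + x') y = tens x y + tens x' y;
  tensDr : forall x y y', tens x (y + y') = tens x y + tens x y';
  tensZl : forall (l : R[i]) x y, tens (l *: x) y = l *: tens x y;
  tensZr : forall (l : R[i]) x y, tens x (l *: y) = l *: tens x y;
  tens_balanced : forall x a y, tens (hract x a) y = tens x (lact a y);
  tens_ract : forall x y a, hract (tens x y) a = tens x (hract y a);
  tens_lact : forall a x y, lact a (tens x y) = tens (lact a x) y;
  tens_inner : forall x y x' y',
    inner (tens x y) (tens x' y') = inner y (lact (inner x x') y');
  tens_dense : closure [set z | exists (r : nat) (x : 'I_r -> X) (y : 'I_r -> Y),
                                  z = \sum_(i < r) tens (x i) (y i)] = setT
}.

(* A as a correspondence over itself, with <a, b> = a^* b. *)
Section IdCorrespondence.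
Variables (R : realType) (A : cstar_algebra R).

Let inner_id (a b : A) : A := amul (astar a) b.

Let inner_id_ract (a b c : A) : inner_id a (amul b c) = amul (inner_id a b) c.
Proof. exact: amulA. Qed.

Let inner_id_star (a b : A) : astar (inner_id a b) = inner_id b a.
Proof. by rewrite /inner_id astarM astarK. Qed.

Let inner_id_ge0 (a : A) : apositive (inner_id a a).
Proof. by exists a. Qed.

Let inner_id_norm (a : A) : `|a| ^+ 2 = `|inner_id a a|.
Proof. by rewrite norm_cstar. Qed.

Let inner_id_eq0 (a : A) : inner_id a a = 0 -> a = 0.
Proof.
move=> a0; apply/eqP; rewrite -normr_eq0.
have: `|a| ^+ 2 == 0 by rewrite inner_id_norm a0 normr0.
by rewrite expf_eq0.
Qed.

Let lact_id_adj (a b c : A) : inner_id (amul a b) c = inner_id b (amul (astar a) c).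
Proof. by rewrite /inner_id astarM amulA. Qed.

Definition id_module : hilbert_module A :=
  @HilbertModule R A A (@amul R A) inner_id (@amulDl R A) (@amulDr R A)
    (@amulZl R A) (@amulZr R A) (@amulA R A)
    (fun a => @amulDr R A (astar a)) (fun l a => @amulZr R A l (astar a))
    inner_id_ract inner_id_star inner_id_ge0 inner_id_eq0 inner_id_norm.

Definition id_correspondence : correspondence A :=
  @Correspondence R A id_module (@amul R A) (@amulDl R A) (@amulZl R A)
    (fun a b c => esym (@amulA R A a b c)) lact_id_adj.

End IdCorrespondence.

Definition transport (R : realType) (A : cstar_algebra R) (n : nat)
    (X : {ffun 'I_n -> nat} -> correspondence A)
    (m m' : {ffun 'I_n -> nat}) (e : m = m') (x : X m) : X m' :=
  eq_rect m (fun p => X p : Type) x m' e.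

(* N^n-product systems. The tensor products are only determined up to
   isomorphism, so ps_tens records the models on which the isomorphisms ps_iso
   are defined. *)
Record product_system (R : realType) (n : nat) (A : cstar_algebra R) :=
    ProductSystem {
  fiber :> {ffun 'I_n -> nat} -> correspondence A;
  fiber0 : fiber 0 = id_correspondence A;
  ps_tens : forall m k, tensor_product (fiber m) (fiber k);
  ps_iso : forall m k : {ffun 'I_n -> nat}, m != 0 -> k != 0 ->
    corr_iso (ps_tens m k) (fiber (m + k));
  ps_mul := fun (m k : {ffun 'I_n -> nat}) (hm : m != 0) (hk : k != 0)
      (x : fiber m) (y : fiber k) =>
    ps_iso hm hk (tens (ps_tens m k) x y);
  ps_assoc : forall (m k l : {ffun 'I_n -> nat})
      (hm : m != 0) (hk : k != 0) (hl : l != 0)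
      (hmk : m + k != 0) (hkl : k + l != 0)
      (x : fiber m) (y : fiber k) (z : fiber l),
    transport (addrA m k l) (ps_mul hm hkl x (ps_mul hk hl y z))
      = ps_mul hmk hl (ps_mul hm hk x y) z
}.

Definition is_proper (R : realType) (n : nat) (A : cstar_algebra R)
    (X : product_system n A) : Prop :=
  forall m a, compact_operator (@lact R A (X m) a).

(* X J, as the closed linear span of the products x a with a in J. *)
Definition module_ideal (R : realType) (A : cstar_algebra R)
    (X : hilbert_module A) (J : set A) : set X :=
  closure [set z | exists (r : nat) (x : 'I_r -> X) (a : 'I_r -> A),
    (forall i, J (a i)) /\ z = \sum_(i < r) hract (x i) (a i)].

(* The ideal (X^m)^{-1}(J), with (X^0)^{-1}(J) = J by convention. *)
Definition inv_ideal (R : realType) (n : nat) (A : cstar_algebra R)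
    (X : product_system n A) (m : {ffun 'I_n -> nat}) (J : set A) : set A :=
  if m == 0 then J else [set a | forall x : X m, module_ideal J (lact a x)].

Definition char_vec (n : nat) (F : {set 'I_n}) : {ffun 'I_n -> nat} :=
  [ffun i => nat_of_bool (i \in F)].

(* 1 - 1_F; the truncated subtraction is exact since 1_F <= 1. *)
Definition cochar_vec (n : nat) (F : {set 'I_n}) : {ffun 'I_n -> nat} :=
  [ffun i => (char_vec [set: 'I_n]%SET i - char_vec F i)%N].

Definition ideal_family (R : realType) (n : nat) (A : cstar_algebra R) : Type :=
  {set 'I_n} -> set A.

Definition invariant_family (R : realType) (n : nat) (A : cstar_algebra R)
    (X : product_system n A) : set (ideal_family n A) :=
  [set K | (forall F, is_ideal (K F)) /\
    (forall (G : {set 'I_n}) (i : 'I_n), i \notin G ->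
       K G = inv_ideal X (char_vec [set i]%SET) (K G `&` K (i |: G)%SET))].

Definition T_family (R : realType) (n : nat) (A : cstar_algebra R)
    (X : product_system n A) : set (ideal_family n A) :=
  [set I | (forall F, is_ideal (I F)) /\
    (forall (F : {set 'I_n}) (i : 'I_n), i \notin F ->
       I F = inv_ideal X (char_vec [set i]%SET) (I F) `&` I (i |: F)%SET)].

Definition fam_le (R : realType) (n : nat) (A : cstar_algebra R)
    (K1 K2 : ideal_family n A) : Prop :=
  forall F, K1 F `<=` K2 F.

Definition is_meet (R : realType) (n : nat) (A : cstar_algebra R)
    (S : set (ideal_family n A)) (K1 K2 M : ideal_family n A) : Prop :=
  [/\ S M, fam_le M K1, fam_le M K2 &
    forall L, S L -> fam_le L K1 -> fam_le L K2 -> fam_le L M].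

Definition is_join (R : realType) (n : nat) (A : cstar_algebra R)
    (S : set (ideal_family n A)) (K1 K2 M : ideal_family n A) : Prop :=
  [/\ S M, fam_le K1 M, fam_le K2 M &
    forall L, S L -> fam_le K1 L -> fam_le K2 L -> fam_le M L].

Definition is_lattice (R : realType) (n : nat) (A : cstar_algebra R)
    (S : set (ideal_family n A)) : Prop :=
  forall K1 K2, S K1 -> S K2 ->
    (exists M, is_meet S K1 K2 M) /\ (exists M, is_join S K1 K2 M).

Record lattice_morphism (R : realType) (n : nat) (A : cstar_algebra R)
    (S T : set (ideal_family n A)) (f : ideal_family n A -> ideal_family n A) : Prop := {
  lm_fun : forall K, S K -> T (f K);
  lm_le : forall K1 K2, S K1 -> S K2 -> fam_le K1 K2 -> fam_le (f K1) (f K2);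
  lm_meet : forall K1 K2 M, S K1 -> S K2 ->
    is_meet S K1 K2 M -> is_meet T (f K1) (f K2) (f M);
  lm_join : forall K1 K2 M, S K1 -> S K2 ->
    is_join S K1 K2 M -> is_join T (f K1) (f K2) (f M)
}.

(* K |-> I_K *)
Definition T_of_invariant (R : realType) (n : nat) (A : cstar_algebra R)
    (K : ideal_family n A) : ideal_family n A :=
  fun F => \bigcap_(G in [set G : {set 'I_n} | F \subset G]) K G.

(* I |-> K_I *)
Definition invariant_of_T (R : realType) (n : nat) (A : cstar_algebra R)
    (X : product_system n A) (I : ideal_family n A) : ideal_family n A :=
  fun F => inv_ideal X (cochar_vec F) (I F).

Record lattice_isomorphisms (R : realType) (n : nat) (A : cstar_algebra R)
    (S T : set (ideal_family n A)) (f g : ideal_family n A -> ideal_family n A) : Prop := {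
  li_lattice_dom : is_lattice S;
  li_lattice_cod : is_lattice T;
  li_morph : lattice_morphism S T f;
  li_morph_inv : lattice_morphism T S g;
  li_K : forall K, S K -> g (f K) = K;
  li_Kinv : forall I, T I -> f (g I) = I
}.

(* Main.v *)
Require Import Defs.
From mathcomp Require Import all_boot all_order all_algebra.
From mathcomp Require Import all_classical all_reals all_analysis.
From HB Require Import structures.
From mathcomp Require Import complex ring.

(* The key point is that z lies in X J as soon as <y, z> lies in J for all y;
   then (X^m)^{-1}(J) = {a | <y, a x> in J for all x, y}, and these operators
   preserve intersections and compose according to addition of the m's, so they
   commute.  Given an invariant family K, pairing each G with G + i gives
   (X^{1_H})^{-1}(I_K^F) = the intersection of the K^G over the G containing F
   and disjoint from H; H = {i} makes I_K a T-family and H = complement of F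
   recovers K^F.  Conversely, if I is a T-family, an element of I_{K_I}^F lies in
   I^{F + i} for all i by induction, and in (X^{1_H})^{-1}(I^F) for H the
   complement of F; the T-equation then removes the points of H one at a time.
   Both kinds of families are stable under intersections, hence form lattices.

   The key point needs an approximate unit.  With b = <x, x> and
   w = 1 + i t b, the mean q of the w^(N-1-j) (w^* )^j is 1 modulo the ideal
   generated by b, right multiplication by q is bounded as long as N t^2 |b|^2
   is, and b q = (w^N - (w^* )^N) / (2 i t N) is small, so x q is small.
   Closedness of (X^m)^{-1}(J) needs the left action to be bounded: a small
   self-adjoint h is the real part of a unitary h + i (1 - s) of the
   unitization, with s a fixed point of s |-> (h^2 + s^2) / 2. *)

Set Implicit Arguments.
Unset Strict Implicit.
Unset Printing Implicit Defensive.

Import Order.TTheory GRing.Theory Num.Theory.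
Import numFieldNormedType.Exports.

Local Open Scope classical_set_scope.
Local Open Scope ring_scope.

(** * C*-algebra identities and a Cauchy-Schwarz estimate in Hilbert modules *)

Section CstarBasics.
Variables (R : realType) (A : cstar_algebra R).
Implicit Types a b : A.

Lemma amul0r a : amul 0 a = 0.
Proof. by apply: (addIr (amul 0 a)); rewrite -amulDl !add0r. Qed.

Lemma amulr0 a : amul a 0 = 0.
Proof. by apply: (addIr (amul a 0)); rewrite -amulDr !add0r. Qed.

Lemma astar0 : astar (0 : A) = 0.
Proof. by apply: (addIr (astar (0 : A))); rewrite -astarD !add0r. Qed.

Lemma astarN a : astar (- a) = - astar a.
Proof. by apply: (addrI (astar a)); rewrite -astarD !subrr astar0. Qed.

Lemma norm_astar a : `|astar a| = `|a|.
Proof.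
have le_star b : `|b| <= `|astar b|.
  have [->|b0] := eqVneq b 0; first by rewrite astar0.
  have b_gt0 : 0 < `|b| by rewrite normr_gt0.
  rewrite -(ler_pM2r b_gt0) -expr2 -norm_cstar; exact: norm_amul.
by apply/le_anti; rewrite le_star -{2}(astarK a) le_star.
Qed.

End CstarBasics.

Section HilbertModuleBasics.
Variables (R : realType) (A : cstar_algebra R) (X : hilbert_module A).
Implicit Types (x y z : X) (a : A).

Lemma ractr0 x : hract x 0 = 0.
Proof. by apply: (addIr (hract x 0)); rewrite -ractDr !add0r. Qed.

Lemma inner0r x : inner x (0 : X) = 0.
Proof. by apply: (addIr (inner x 0)); rewrite -innerD !add0r. Qed.

Lemma innerN x y : inner x (- y) = - inner x y.
Proof. by apply: (addrI (inner x y)); rewrite -innerD !subrr inner0r. Qed.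

Lemma innerDl x y z : inner (x + y) z = inner x z + inner y z.
Proof. by rewrite -inner_star innerD astarD !inner_star. Qed.

Lemma innerZl (l : R[i]) x y : inner (l *: x) y = l^* *: inner x y.
Proof. by rewrite -inner_star innerZ astarZ inner_star. Qed.

Lemma inner_sum (r : nat) (x : X) (f : 'I_r -> X) :
  inner x (\sum_(i < r) f i) = \sum_(i < r) inner x (f i).
Proof.
by elim/big_rec2: _ => [|i u v _ <-]; [rewrite inner0r | rewrite innerD].
Qed.

Lemma inner_suml (r : nat) (x : X) (f : 'I_r -> X) :
  inner (\sum_(i < r) f i) x = \sum_(i < r) inner (f i) x.
Proof.
have inner0l : inner (0 : X) x = 0 by rewrite -inner_star inner0r astar0.
by elim/big_rec2: _ => [|i u v _ <-]; rewrite ?inner0l ?innerDl.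
Qed.

(** Subtracting ['i] times the second square cancels [inner y x] and doubles [inner x y]; the
    diagonal terms that remain are removed last. Only norms of squares are then left to estimate. *)
Lemma inner_polarization x y :
  inner x y + inner x y =
  inner (x + y) (x + y) - ('i : R[i]) *: inner (x + ('i : R[i]) *: y) (x + ('i : R[i]) *: y)
    - (1 - 'i : R[i]) *: (inner x x + inner y y).
Proof.
have ii : 'i * 'i = -1 :> R[i] by rewrite -expr2 sqrCi.
have -> : inner (x + y) (x + y) = inner x y + inner y x + (inner x x + inner y y).
  by rewrite innerD !innerDl addrA [LHS](ACl (3*2*(1*4))).
have -> : inner (x + ('i : R[i]) *: y) (x + ('i : R[i]) *: y) =
    ('i : R[i]) *: inner x y - ('i : R[i]) *: inner y x + (inner x x + inner y y).
  rewrite innerD !innerDl !innerZ !innerZl !conjCi scalerA mulrN ii opprK scale1r.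
  by rewrite scaleNr addrA [LHS](ACl (3*2*(1*4))).
rewrite scalerDr scalerBr !scalerA ii !scaleN1r opprK scalerBl scale1r.
set p := inner x y; set q := inner y x; set s := inner x x + inner y y.
set t := _ *: s.
rewrite !opprD !opprK !addrA.
by rewrite [RHS](ACl (1*5*(2*6)*(3*8)*(4*9)*(7*10))) /= !subrr addNr !addr0.
Qed.

(* Polarization gives Cauchy-Schwarz up to a constant without any order theory
   in A, and the constant is irrelevant for continuity. *)
Lemma norm_inner_le x y : `|inner x y| <= 6 * (`|x| * `|y|).
Proof.
have unit_case (u v : X) : `|u| <= 1 -> `|v| <= 1 -> `|inner u v| <= 6.
  move=> u1 v1.
  have sq (z : X) : `|inner z z| = `|z| ^+ 2 by rewrite hm_norm.
  have le4 (z : X) : `|z| <= 2 -> `|inner z z| <= 4.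
    move=> z2; rewrite sq (_ : 4 = 2 ^+ 2); last by ring.
    by rewrite lerXn2r ?nnegrE.
  have le1 (z : X) : `|z| <= 1 -> `|inner z z| <= 1.
    by move=> z1; rewrite sq expr_le1.
  have ni : `|'i : R[i]| = 1 by rewrite normCi.
  have h1 : `|inner (u + v) (u + v)| <= 4.
    apply: le4; apply: le_trans (ler_normD _ _) _.
    by rewrite (_ : 2 = 1 + 1) ?lerD.
  have h2 : `|inner (u + ('i : R[i]) *: v) (u + ('i : R[i]) *: v)| <= 4.
    apply: le4; apply: le_trans (ler_normD _ _) _.
    by rewrite normrZ ni mul1r (_ : 2 = 1 + 1) ?lerD.
  have h3 : `|1 - 'i : R[i]| <= 2.
    by apply: le_trans (ler_normB _ _) _; rewrite normr1 ni (_ : 2 = 1 + 1).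
  have h4 : `|inner u u + inner v v| <= 2.
    apply: le_trans (ler_normD _ _) _.
    by rewrite (_ : 2 = 1 + 1) ?lerD ?le1.
  have : `|inner u v + inner u v| <= 12.
    rewrite inner_polarization; apply: le_trans (ler_normB _ _) _.
    rewrite (_ : 12 = (4 + 4) + 2 * 2); last by ring.
    apply: lerD; last by rewrite normrZ ler_pM.
    apply: le_trans (ler_normB _ _) _.
    by rewrite normrZ ni mul1r lerD.
  rewrite -mulr2n normrMn (_ : 12 = 6 *+ 2); last by ring.
  by rewrite lerMn2r.
have [->|x0] := eqVneq x 0.
  by rewrite normr0 mul0r mulr0 -(scale0r (0 : X)) innerZl conjC0 scale0r normr0.
have [->|y0] := eqVneq y 0.
  by rewrite inner0r !normr0 !mulr0.
have norm_unit (z : X) : z != 0 -> `| (`|z|^-1 *: z) | <= 1.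
  by move=> z0; rewrite normrZ normfV normr_id mulVf ?normr_eq0.
have := unit_case _ _ (norm_unit _ x0) (norm_unit _ y0).
rewrite innerZ innerZl !normrZ norm_conjC !normfV !normr_id.
rewrite mulrA -invfM ler_pdivrMl ?mulr_gt0 ?normr_gt0 //.
by rewrite mulrC [`|x| * _]mulrC.
Qed.

End HilbertModuleBasics.

(** * The unitization of A and its action on Hilbert modules *)

Definition unitization (R : realType) (A : cstar_algebra R) : Type :=
  (R[i] * A)%type.

Section Unitization.
Variables (R : realType) (A : cstar_algebra R).
Local Notation U := (unitization A).
HB.instance Definition _ := GRing.Zmodule.on U.

Definition umul (u v : U) : U :=
  (u.1 * v.1, u.1 *: v.2 + v.1 *: u.2 + amul u.2 v.2).
Definition uone : U := (1, 0).

Let umulA : associative umul.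
Proof.
move=> [l a] [m b] [k c]; rewrite /umul /= mulrA; congr pair.
rewrite !scalerDr !amulDl !amulDr !amulZl !amulZr !scalerA amulA !addrA.
by rewrite [m * k]mulrC [k * l]mulrC [LHS](ACl (1*2*4*6*3*5*7)).
Qed.

Let umul1r : left_id uone umul.
Proof.
move=> [l a]; rewrite /umul /uone /= mul1r scale1r scaler0 amul0r !addr0 //.
Qed.

Let umulr1 : right_id uone umul.
Proof.
move=> [l a]; rewrite /umul /uone /= mulr1 scale1r scaler0 amulr0 addr0 add0r //.
Qed.

Let umulDl : left_distributive umul +%R.
Proof.
move=> [l a] [m b] [k c]; rewrite /umul /= mulrDl; congr pair.
rewrite scalerDl scalerDr amulDl !addrA.
by rewrite [LHS](ACl (1*3*5*2*4*6)).
Qed.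

Let umulDr : right_distributive umul +%R.
Proof.
move=> [l a] [m b] [k c]; rewrite /umul /= mulrDr; congr pair.
rewrite scalerDl scalerDr amulDr !addrA.
by rewrite [LHS](ACl (1*3*5*2*4*6)).
Qed.

Let uone_neq0 : uone != 0.
Proof. by apply/eqP => -[/eqP]; rewrite oner_eq0. Qed.

HB.instance Definition _ := GRing.Zmodule_isNzRing.Build U
  umulA umul1r umulr1 umulDl umulDr uone_neq0.

Definition uin (a : A) : U := (0, a).
Definition uscal (l : R[i]) : U := (l, 0).
Definition ustar (u : U) : U := (u.1^*, astar u.2).

Lemma uinD a b : uin (a + b) = uin a + uin b.
Proof. by congr pair; rewrite addr0. Qed.

Lemma uinM a b : uin (amul a b) = uin a * uin b.
Proof. by congr pair; rewrite /= ?mulr0 // !scale0r !add0r. Qed.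

Lemma uin_inj : injective uin.
Proof. by move=> a b []. Qed.

Lemma uscalM l m : uscal (l * m) = uscal l * uscal m.
Proof. by congr pair; rewrite /= !scaler0 amulr0 !addr0. Qed.

Lemma uscalD l m : uscal (l + m) = uscal l + uscal m.
Proof. by congr pair; rewrite /= addr0. Qed.

Lemma uscalN l : uscal (- l) = - uscal l.
Proof. by congr pair; rewrite /= oppr0. Qed.

Lemma uscal_comm l u : GRing.comm (uscal l) u.
Proof.
by congr pair; rewrite /= ?[l * _]mulrC // scaler0 amul0r amulr0 !addr0 add0r.
Qed.

Lemma uinZ l a : uin (l *: a) = uscal l * uin a.
Proof. by congr pair; rewrite /= ?mulr0 // scaler0 amul0r !addr0. Qed.

Lemma ustarK : involutive ustar.
Proof. by move=> [l a]; rewrite /ustar /= conjCK astarK. Qed.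

Lemma ustarD u v : ustar (u + v) = ustar u + ustar v.
Proof. by congr pair; rewrite ?rmorphD ?astarD. Qed.

Lemma ustarM u v : ustar (u * v) = ustar v * ustar u.
Proof.
congr pair; rewrite /= ?rmorphM 1?mulrC //.
rewrite !astarD !astarZ astarM; congr (_ + _); exact: addrC.
Qed.

Lemma ustar_in a : ustar (uin a) = uin (astar a).
Proof. by rewrite /ustar /= conjC0. Qed.

Lemma ustar_scal l : ustar (uscal l) = uscal l^*.
Proof. by rewrite /ustar /= astar0. Qed.

Lemma ustar1 : ustar 1 = 1.
Proof. by rewrite /ustar /= conjC1 astar0. Qed.

Lemma ustarX u k : ustar (u ^+ k) = ustar u ^+ k.
Proof. by elim: k => [|k IH]; rewrite ?ustar1 // exprS ustarM IH -exprSr. Qed.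

End Unitization.

Section UnitizationAction.
Variables (R : realType) (A : cstar_algebra R).
Local Notation U := (unitization A).
Implicit Types u v : U.

Definition uract (X : hilbert_module A) (x : X) (u : U) : X :=
  u.1 *: x + hract x u.2.

Section Hilbert.
Variable X : hilbert_module A.
Implicit Types x y : X.

(** Since [u] and [v] have scalar parts, the product is formed in the unitization; it lands back in
    A, which is an ideal there. *)
Lemma inner_uract x y u v :
  uin (inner (uract x u) (uract y v)) = ustar u * uin (inner x y) * v.
Proof.
have inr z w t : uin (inner z (uract w t)) = uin (inner z w) * t.
  rewrite /uract innerD innerZ inner_ract; congr pair; rewrite /= ?mul0r //.
  by rewrite scale0r add0r.
by rewrite inr -inner_star -ustar_in inr ustarM ustar_in inner_star.
Qed.

End Hilbert.

End UnitizationAction.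

(** * Right multiplication on A by elements of the unitization *)

Section RightMultiplicationBound.
Variables (R : realType) (A : cstar_algebra R).
Local Notation U := (unitization A).
Implicit Types (u v : U) (C D : R[i]).

Lemma uin_mulE (a : A) u : uin a * u = uin (uin a * u).2.
Proof. by congr pair; rewrite /= mul0r. Qed.

Lemma norm_amul_star (a : A) : `|amul a (astar a)| = `|a| ^+ 2.
Proof. by rewrite -{1}(astarK a) norm_cstar norm_astar. Qed.

(** A substitute for a norm on the unitization: [uin a * u] has scalar part 0, so its second
    component is the element [a u] of A. *)
Definition rmul_bounded C u := forall a : A, `|(uin a * u).2| <= C * `|a|.

Lemma rmul_boundedM C D u v : 0 <= D ->
  rmul_bounded C u -> rmul_bounded D v -> rmul_bounded (C * D) (u * v).
Proof.
move=> D0 hu hv a; rewrite mulrA uin_mulE; apply: le_trans (hv _) _.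
by rewrite mulrAC [leRHS]mulrC ler_wpM2l.
Qed.

Lemma rmul_boundedD C D u v :
  rmul_bounded C u -> rmul_bounded D v -> rmul_bounded (C + D) (u + v).
Proof.
move=> hu hv a; rewrite mulrDr mulrDl; apply: le_trans (ler_normD _ _) _.
exact: lerD.
Qed.

Lemma rmul_bounded1 : rmul_bounded 1 1.
Proof. by move=> a; rewrite mulr1 mul1r. Qed.

Lemma rmul_bounded_scal l : rmul_bounded `|l| (uscal A l).
Proof. by move=> a; rewrite -uscal_comm -uinZ /= normrZ. Qed.

Lemma rmul_bounded_in (a : A) : rmul_bounded `|a| (uin a).
Proof. by move=> b; rewrite -uinM mulrC /= norm_amul. Qed.

Lemma rmul_boundedX C u k : 0 <= C -> rmul_bounded C u -> rmul_bounded (C ^+ k) (u ^+ k).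
Proof.
move=> C0 hu; elim: k => [|k IH]; first exact: rmul_bounded1.
by rewrite !exprSr; apply: rmul_boundedM.
Qed.

Lemma rmul_bounded_sum C k (f : 'I_k -> U) : (forall i, rmul_bounded C (f i)) ->
  rmul_bounded (C *+ k) (\sum_(i < k) f i).
Proof.
move=> hf; rewrite -[k in C *+ k]card_ord -sumr_const.
elim/big_rec2: _ => [a|i D u _ hu].
  by rewrite mulr0 mul0r normr0.
exact: rmul_boundedD.
Qed.

(** The C*-identity gives [|a u|^2 = |a u u^* a^*| <= |a u u^*| |a|]. *)
Lemma rmul_bounded_of_star C u : 0 <= C ->
  rmul_bounded (C ^+ 2) (u * ustar u) -> rmul_bounded C u.
Proof.
move=> C0 hu a.
rewrite -(@ler_pXn2r _ 2) ?nnegrE ?mulr_ge0 // -norm_amul_star.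
set c := (uin a * u).2.
have -> : amul c (astar c) = amul (uin a * (u * ustar u)).2 (astar a).
  apply: uin_inj; rewrite !uinM -uin_mulE -ustar_in -uin_mulE ustarM ustar_in.
  by rewrite !mulrA.
apply: le_trans (norm_amul _ _) _; rewrite norm_astar exprMn [`|a| ^+ 2]expr2 [leRHS]mulrA.
exact: ler_wpM2r (hu a).
Qed.

End RightMultiplicationBound.

(** * An approximate unit from powers of 1 + i t b *)

Lemma comm_sqr_reorder (U : nzRingType) (b q r : U) :
  GRing.comm b q -> GRing.comm b r -> GRing.comm q r ->
  r * b * q * (r * b * q) = b * (b * q * (q * (r * r))).
Proof.
move=> bq br qr; rewrite -br -!mulrA; congr (_ * _).
rewrite [q * (b * _)]mulrA -bq -!mulrA [r * (b * _)]mulrA -br.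
rewrite -!mulrA; congr (_ * _); rewrite -qr [LHS]mulrA -qr -!mulrA.
by congr (_ * _); rewrite [LHS]mulrA -qr -mulrA.
Qed.

Section ApproximateUnit.
Variables (R : realType) (A : cstar_algebra R).
Local Notation U := (unitization A).

(** The hypothesis absorbs the quadratic term of the induction:
    [(1 + 2 k s)(1 + s) <= 1 + 2 k s + 2 s] because [2 k s <= 1]. *)
Lemma expr1D_le (s : R[i]) k : 0 <= s -> s *+ (2 * k) <= 1 ->
  (1 + s) ^+ k <= 1 + s *+ (2 * k).
Proof.
move=> s0; elim: k => [|k IH] hk; first by rewrite muln0 mulr0n addr0.
have hk' : s *+ (2 * k) <= 1.
  by apply: le_trans hk; apply: ler_wpMn2l => //; rewrite mulnS leq_addl.
rewrite exprSr; apply: le_trans (ler_wpM2r _ (IH hk')) _; first exact: addr_ge0.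
rewrite mulnS [s *+ (2 + _)]mulrnDr mulr2n mulrDr mulr1 -[leLHS]addrA lerD2l.
rewrite [leRHS]addrC lerD2l mulrDl mul1r lerD2l.
by rewrite ler_piMl.
Qed.

Variables (b : A) (t : R[i]) (N : nat).
Hypotheses (b_sa : astar b = b) (t_ge0 : 0 <= t) (N_gt0 : (0 < N)%N).
Hypothesis small : (t ^+ 2 * `|b| ^+ 2) *+ (2 * N) <= 1.

Let w : U := 1 + uscal A ('i * t) * uin b.
Let w' : U := 1 - uscal A ('i * t) * uin b.

Let w_comm : GRing.comm w w'.
Proof.
apply: commrB; first exact: commr1.
by apply/commr_sym/commrD => //; exact: commr1.
Qed.

Let w_star : ustar w = w'.
Proof.
rewrite /w /w' ustarD ustar1 ustarM ustar_in b_sa ustar_scal rmorphM /= conjCi.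
rewrite (CrealP (ger0_real t_ge0)) -uscal_comm mulNr; congr (_ + _).
by rewrite uscalN mulNr.
Qed.

Let w'_star : ustar w' = w.
Proof. by rewrite -w_star ustarK. Qed.

Let ww' : w * w' = 1 + uscal A (t ^+ 2) * (uin b * uin b).
Proof.
rewrite /w /w' mulrBr mulr1 mulrDl mul1r opprD addrA addrK; congr (_ + _).
rewrite -!mulrA [uin b * (_ * _)]mulrA -uscal_comm -!mulrA [_ * (_ * (uin b * uin b))]mulrA.
rewrite -uscalM -mulNr -uscalN; congr (uscal _ _ * _).
by rewrite mulrACA -expr2 sqrCi mulN1r opprK.
Qed.

(** The star swaps the commuting elements [w] and [w'], so [u u^*] is [(w w')^(j + k)] for
    [u = w^j w'^k]. Here [w w' = 1 + t^2 b^2], and [small] keeps the bound of this power at most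
    2. *)
Lemma rmul_bounded_cayley_power j k : (j + k <= N)%N ->
  rmul_bounded 2 (w ^+ j * w' ^+ k).
Proof.
move=> jkN; apply: rmul_bounded_of_star => //.
have -> : w ^+ j * w' ^+ k * ustar (w ^+ j * w' ^+ k) = (w * w') ^+ (j + k).
  have cXX m l : w' ^+ m * w ^+ l = w ^+ l * w' ^+ m.
    by apply/commr_sym/commrX/commr_sym/commrX/commr_sym.
  rewrite ustarM !ustarX w_star w'_star exprMn_comm // -mulrA.
  by rewrite [w' ^+ k * _]mulrA cXX -!mulrA -exprD mulrA -exprD [(k + j)%N]addnC.
have s0 : 0 <= t ^+ 2 * `|b| ^+ 2 by rewrite mulr_ge0 ?exprn_ge0.
have h1 : rmul_bounded (1 + t ^+ 2 * `|b| ^+ 2) (w * w').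
  rewrite ww'; apply: rmul_boundedD; first exact: rmul_bounded1.
  rewrite -{1}[t ^+ 2]ger0_norm ?exprn_ge0 //.
  apply: rmul_boundedM; rewrite ?exprn_ge0 //; first exact: rmul_bounded_scal.
  by rewrite expr2; apply: rmul_boundedM => //; exact: rmul_bounded_in.
move=> a; apply: le_trans (rmul_boundedX _ _ h1 _) _; first by rewrite addr_ge0.
rewrite ler_wpM2r //.
apply: le_trans (_ : (1 + t ^+ 2 * `|b| ^+ 2) ^+ N <= _).
  by rewrite ler_weXn2l // lerDl.
apply: le_trans (expr1D_le s0 small) _.
(* [rmul_bounded_of_star] asks for [2 ^+ 2], so the bound 2 obtained here leaves room. *)
apply: le_trans (_ : 1 + 1 <= _); first by rewrite lerD2l.
by rewrite -[1 + 1]/(2%:R) -natrX ler_nat.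
Qed.

Let S : U := \sum_(i < N) w ^+ (N.-1 - i) * w' ^+ i.

Definition cayley_mean : U := uscal A N%:R^-1 * S.
Let q := cayley_mean.

Let ord_le (i : 'I_N) : (N.-1 - i + i <= N)%N.
Proof. by rewrite subnK ?leq_pred //; case: N i => [[]|m i] //=; rewrite -ltnS. Qed.

Let normN : `|N%:R^-1 : R[i]| = N%:R^-1.
Proof. by rewrite ger0_norm // invr_ge0. Qed.

Let mean_bound u : rmul_bounded (2 *+ N) u -> rmul_bounded 2 (uscal A N%:R^-1 * u).
Proof.
move=> hu; have -> : 2 = `|N%:R^-1 : R[i]| * (2 *+ N) :> R[i].
  by rewrite normN -[2 *+ N]mulr_natr mulrC mulfK // pnatr_eq0 -lt0n.
by apply: rmul_boundedM => //; exact: rmul_bounded_scal.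
Qed.

Lemma rmul_bounded_cayley_mean : rmul_bounded 2 q.
Proof.
by apply/mean_bound/rmul_bounded_sum => i; exact: rmul_bounded_cayley_power.
Qed.

Let q_star : ustar q = uscal A N%:R^-1 * \sum_(i < N) w ^+ i * w' ^+ (N.-1 - i).
Proof.
rewrite /q /cayley_mean ustarM ustar_scal (CrealP _); last by rewrite realV realn.
rewrite -uscal_comm; congr (_ * _).
rewrite /S (big_morph _ (@ustarD R A) (_ : ustar 0 = 0)).
  by apply: eq_bigr => i _; rewrite ustarM !ustarX w_star w'_star.
by rewrite /ustar /= conjC0 astar0.
Qed.

Lemma rmul_bounded_cayley_mean_star : rmul_bounded 2 (ustar q).
Proof.
rewrite q_star; apply/mean_bound/rmul_bounded_sum => i.
by apply: rmul_bounded_cayley_power; rewrite addnC.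
Qed.

(** The sum in [q] is the cofactor of [w - w'] in [w^N - w'^N], and [w - w' = 2 i t b]. Each of the
    two powers has bound 2, and division by [2 t N] leaves [2 / (t N)]. *)
Lemma rmul_bounded_in_cayley_mean : 0 < t ->
  rmul_bounded (2 / (t * N%:R)) (uin b * q).
Proof.
move=> t_gt0.
have N0 : N%:R != 0 :> R[i] by rewrite pnatr_eq0 -lt0n.
have t0 : t != 0 by rewrite gt_eqF.
have i0 : 'i != 0 :> R[i] by exact: neq0Ci.
have -> : uin b * q = uscal A ('i * t * 2 * N%:R)^-1 * (w ^+ N - w' ^+ N).
  rewrite (subrXX_comm _ w_comm) /q /cayley_mean -/S.
  have -> : w - w' = uscal A ('i * t * 2) * uin b.
    rewrite /w /w' opprD opprK addrACA subrr add0r -mulrDl -uscalD.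
    by congr (uscal _ _ * _); ring.
  rewrite !mulrA -uscalM -[uin b * _]uscal_comm; congr (uscal _ _ * _ * _).
  by field; rewrite N0 t0 i0.
have wN : rmul_bounded 2 (w ^+ N).
  by rewrite -[w ^+ N]mulr1 -(expr0 w'); apply: rmul_bounded_cayley_power; rewrite addn0.
have w'N : rmul_bounded 2 (w' ^+ N).
  by rewrite -[w' ^+ N]mul1r -(expr0 w); apply: rmul_bounded_cayley_power.
have -> : 2 / (t * N%:R) = `|('i * t * 2 * N%:R)^-1| * (2 + 2) :> R[i].
  rewrite normfV !normrM normCi mul1r !normr_nat (ger0_norm t_ge0).
  by field; rewrite N0 t0.
apply: rmul_boundedM => //; first exact: rmul_bounded_scal.
apply: rmul_boundedD => //.
rewrite -mulN1r (_ : - 1 = uscal A (-1)); last by rewrite uscalN.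
rewrite -[2]mul1r -[X in X * 2](normrN1 R[i]).
by apply: rmul_boundedM => //; exact: rmul_bounded_scal.
Qed.

Let comm_scal u l : GRing.comm u (uscal A l).
Proof. exact/commr_sym/uscal_comm. Qed.

Let comm_b_w : GRing.comm (uin b) w.
Proof.
by apply: commrD; [exact: commr1 | apply: commrM => //; exact: comm_scal].
Qed.

Let comm_b_w' : GRing.comm (uin b) w'.
Proof.
by apply: commrB; [exact: commr1 | apply: commrM => //; exact: comm_scal].
Qed.

Let comm_q u : GRing.comm u w -> GRing.comm u w' -> GRing.comm u q.
Proof.
move=> uw uw'; apply: commrM; first exact: comm_scal.
by apply: commr_sum => i _; apply: commrM; apply: commrX.
Qed.

Let comm_qs u : GRing.comm u w -> GRing.comm u w' -> GRing.comm u (ustar q).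
Proof.
move=> uw uw'; rewrite q_star; apply: commrM; first exact: comm_scal.
by apply: commr_sum => i _; apply: commrM; apply: commrX.
Qed.

(** With [y = x q], the element [<y, y>] is [q^* b q], and [|y|^4] is the norm of its square. By
    commutation the square is [b (b q) q q^* q^*], where [b q] is small and the last three factors
    have bound 2. *)
Lemma norm_inner_cayley_mean (X : hilbert_module A) (x : X) : 0 < t ->
  inner x x = b -> `|uract x q| ^+ 4 <= 16 / (t * N%:R) * `|b|.
Proof.
move=> t_gt0 xb; set y := uract x q.
have bq : GRing.comm (uin b) q by exact: comm_q.
have bqs : GRing.comm (uin b) (ustar q) by exact: comm_qs.
have qqs : GRing.comm q (ustar q).
  apply: comm_qs; apply/commr_sym/comm_q => //; exact/commr_sym.
have yE : uin (inner y y) = ustar q * uin b * q by rewrite inner_uract xb.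
have -> : `|y| ^+ 4 = `|amul (inner y y) (inner y y)|.
  by rewrite -{1}inner_star norm_cstar -hm_norm -exprM.
have -> : amul (inner y y) (inner y y) =
    (uin b * (uin b * q * (q * (ustar q * ustar q)))).2.
  by apply: uin_inj; rewrite -uin_mulE uinM yE; exact: comm_sqr_reorder.
(* The leading [b] is the argument at which this bound is evaluated. *)
apply: (_ : rmul_bounded (16 / (t * N%:R)) _).
have -> : 16 / (t * N%:R) = 2 / (t * N%:R) * (2 * (2 * 2)) :> R[i].
  by rewrite mulrAC -!natrM.
apply: rmul_boundedM => //; first exact: rmul_bounded_in_cayley_mean.
apply: rmul_boundedM => //; first exact: rmul_bounded_cayley_mean.
by apply: rmul_boundedM => //; exact: rmul_bounded_cayley_mean_star.
Qed.

(** The elements congruent to 1 modulo [J] include [w] and [w'] and are stable under products and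
    means. This turns smallness of [x q] into an approximation of [x] by some [x a] with [a] in
    [J]. *)
Lemma cayley_mean_ideal (J : set A) : is_ideal J -> J b ->
  q.1 = 1 /\ J q.2.
Proof.
move=> hJ Jb.
pose P (u : U) := u.1 = 1 /\ J u.2.
have P1 : P 1 by split => //; exact: ideal0.
have PM u v : P u -> P v -> P (u * v).
  move=> [u1 u2] [v1 v2]; split; rewrite /= ?u1 ?v1 ?mulr1 // !scale1r.
  by apply: (idealD hJ); [exact: (idealD hJ) | exact: (ideal_mull hJ)].
have PX u k : P u -> P (u ^+ k).
  by move=> Pu; elim: k => [//|k IH]; rewrite exprS; apply: PM.
have Pw : P w.
  split; rewrite /= ?mulr0 ?addr0 // scale0r amul0r addr0 add0r addr0.
  by apply: (idealZ hJ).
have Pw' : P w'.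
  split; rewrite /= ?mulr0 ?subr0 // scale0r amul0r !addr0 sub0r -scaleN1r.
  by do 2! apply: (idealZ hJ).
have Psum k (f : 'I_k -> U) : (forall i, P (f i)) ->
    (\sum_(i < k) f i).1 = k%:R /\ J (\sum_(i < k) f i).2.
  elim: k f => [|k IH] f Pf; first by rewrite big_ord0; split => //; exact: ideal0.
  rewrite big_ord_recr /=; have [h1 h2] := IH _ (fun i => Pf (widen_ord (leqnSn k) i)).
  have [f1 f2] := Pf ord_max.
  by split; [rewrite h1 f1 -natr1 | exact: (idealD hJ)].
have [S1 S2] : S.1 = N%:R /\ J S.2.
  by apply: Psum => i; apply: PM; apply: PX.
split; rewrite /= ?S1 ?mulVf ?pnatr_eq0 -?lt0n //.
rewrite scaler0 amul0r !addr0; exact: (idealZ hJ).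
Qed.

End ApproximateUnit.

(** * Closures, the archimedean property and Cauchy sequences over complex scalars *)

Section NormedClosure.
Variable R : realType.

(** Nonnegative elements of [R[i]] are real, which reduces the claim to the archimedean property of
    [R]. *)
Lemma archi_complex (C e : R[i]) : 0 <= C -> 0 < e ->
  exists k : nat, C / k.+1%:R < e.
Proof.
move=> C0 e0; have /complex_realP[c Ec] := ger0_real C0.
have /complex_realP[d Ed] := gtr0_real e0; subst C e.
move: C0 e0; rewrite -[0]/(real_complex R 0) lecR ltcR => c0 d0.
have hk := archi_boundP (divr_ge0 c0 (ltW d0)).
set k := Num.bound _ in hk; exists k.
rewrite ltr_pdivrMr ?ltr0Sn // -(rmorph_nat (real_complex R)) -rmorphM ltcR.
rewrite -ltr_pdivrMl // mulrC.
by apply: lt_trans hk _; rewrite ltr_nat.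
Qed.

Lemma closure_normP (V : normedModType R[i]) (S : set V) (x : V) :
  closure S x <-> forall e : R[i], 0 < e -> exists2 y, S y & `|x - y| < e.
Proof.
split=> [cl e e0|h B /nbhs_ballP[e /= e0 eB]].
  have [|y [Sy]] := cl (ball x e); first exact: nbhsx_ballx.
  by rewrite -ball_normE => /= ?; exists y.
have [y Sy xy] := h _ e0; exists y; split => //; apply: eB.
by rewrite -ball_normE.
Qed.

Lemma closed_normP (V : normedModType R[i]) (S : set V) :
  (forall x, (forall e : R[i], 0 < e -> exists2 y, S y & `|x - y| < e) -> S x) ->
  closed S.
Proof.
by move=> h x /closure_normP; exact: h.
Qed.

Lemma closed_mem_norm (V : normedModType R[i]) (S : set V) : closed S ->
  forall x, (forall e : R[i], 0 < e -> exists2 y, S y & `|x - y| < e) -> S x.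
Proof. by move=> cS x h; apply: cS; apply/closure_normP. Qed.

Lemma closed_bounded_preimage (V W : normedModType R[i]) (f : V -> W) (C : R[i])
    (J : set W) : (forall x y, `|f x - f y| <= C * `|x - y|) -> 0 <= C ->
  closed J -> closed (f @^-1` J).
Proof.
move=> fC C0 cJ; apply: closed_normP => x h; apply: (closed_mem_norm cJ) => e e0.
(* [C] may be 0, hence the division by [C + 1]. *)
have C1 : 0 < C + 1 by rewrite ltr_wpDl.
have [y Jy xy] := h (e / (C + 1)) (divr_gt0 e0 C1).
exists (f y) => //; apply: le_lt_trans (fC _ _) _.
apply: le_lt_trans (_ : (C + 1) * `|x - y| < e).
  by rewrite ler_wpM2r // lerDl.
by rewrite mulrC -ltr_pdivlMr.
Qed.

(** The explicit rate lets identities about the limit be checked along the sequence, through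
    [eq0_geometric]. *)
Lemma cvg_geometric_steps (V : completeNormedModType R[i]) (u : nat -> V) :
  (forall k, `|u k.+1 - u k| <= 2^-1 ^+ k) ->
  exists l, forall k, `|l - u k| <= 2 * 2^-1 ^+ k.
Proof.
move=> hu.
have tail k m : `|u (k + m)%N - u k| <= 2 * 2^-1 ^+ k.
  (* Subtracting the remaining tail of the geometric series makes the induction on [m] close. *)
  have : `|u (k + m)%N - u k| <= 2 * 2^-1 ^+ k - 2 * 2^-1 ^+ (k + m).
    elim: m => [|m IH]; first by rewrite addn0 !subrr normr0.
    rewrite addnS -(subrK (u (k + m)%N) (u (k + m).+1)) -addrA.
    apply: le_trans (ler_normD _ _) _; apply: le_trans (lerD (hu _) IH) _.
    rewrite exprS mulrA mulfV ?pnatr_eq0 // mul1r addrCA lerD2l.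
    by rewrite mulr2n mulrDl mul1r opprD addrA subrr add0r.
  move=> /le_trans; apply; rewrite lerBlDr lerDl.
  by rewrite mulr_ge0 // exprn_ge0 // invr_ge0.
have cu : cauchy (u @ \oo).
  apply/cauchy_ballP => e e0.
  have [k hk] := archi_complex (ler0n _ 4) e0; near_simpl.
  exists ([set n | (k <= n)%N], [set n | (k <= n)%N]); first by split; exists k.
  move=> [m n] [/= km kn]; rewrite -ball_normE /=.
  rewrite -(subnKC km) -(subnKC kn).
  rewrite -(subrK (u k) (u (k + (m - k))%N)) -addrA.
  apply: le_lt_trans (ler_normD _ _) _; rewrite [`|u k - _|]distrC.
  apply: le_lt_trans (lerD (tail _ _) (tail _ _)) _.
  apply: le_lt_trans hk; rewrite (_ : _ + _ = 4 * 2^-1 ^+ k); last by ring.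
  rewrite ler_wpM2l // exprVn lef_pV2 ?posrE ?exprn_gt0 // -natrX ler_nat.
  exact: ltn_expl.
have /cvg_ex[l hl] : cvg (u @ \oo) by apply: cauchy_cvg.
exists l => k; have hc : closed [set x | `|x - u k| <= 2 * 2^-1 ^+ k].
  apply: closed_normP => x hx /=.
  apply/ler_addgt0Pr => e e0; have [y /= hy xy] := hx _ e0.
  rewrite -(subrK y x) -addrA addrC; apply: le_trans (ler_normD _ _) _.
  by apply: lerD => //; exact: ltW.
apply: (closed_cvg _ hc _ _ hl).
by exists k => // n /= kn; rewrite -(subnKC kn); exact: tail.
Qed.

End NormedClosure.

(** * The submodule X J through inner products *)

Section ModuleIdeal.
Variables (R : realType) (A : cstar_algebra R).
Variables (X : hilbert_module A) (J : set A).
Hypothesis hJ : is_ideal J.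

(** The witness is [- q.2] for a Cayley mean [q] of [b = <x, x>], so that [x - x a = x q]. *)
Lemma ideal_approx_unit (x : X) (e : R[i]) : J (inner x x) -> 0 < e ->
  exists2 a, J a & `|x - hract x a| < e.
Proof.
set b := inner x x => Jb e0.
have b_sa : astar b = b by exact: inner_star.
(* A bound for [|b|] that is invertible even when [b] is 0. *)
pose B := `|b| + 1.
have B0 : 0 < B by rewrite ltr_wpDl.
have C0 : 0 <= 16 * (B * `|b|) by rewrite !mulr_ge0 // ltW.
have [k0 hk] := archi_complex C0 (exprn_gt0 4 e0).
move: hk (ltn0Sn k0); move: k0.+1 => k hk k_gt0.
have k0' : k%:R != 0 :> R[i] by rewrite pnatr_eq0 -lt0n.
have B0' : B != 0 by rewrite gt_eqF.
(* With [N = 2 k^2] this makes [2 N t^2 B^2] equal to 1 and [t N] equal to [k / B]. The estimate for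
   [|x q|^4] becomes [16 B |b| / k], which the choice of [k] puts below [e^4]. *)
pose t : R[i] := (2 * k%:R * B)^-1.
have t0 : 0 < t by rewrite invr_gt0 !mulr_gt0 ?ltr0n.
pose N := (2 * k ^ 2)%N.
have N0 : (0 < N)%N by rewrite muln_gt0 expn_gt0 k_gt0.
have small : (t ^+ 2 * `|b| ^+ 2) *+ (2 * N) <= 1.
  apply: le_trans (_ : (t ^+ 2 * B ^+ 2) *+ (2 * N) <= _).
    rewrite lerMn2r; apply/orP; right; apply: ler_wpM2l; first exact/exprn_ge0/ltW.
    by rewrite ler_pXn2r ?nnegrE ?(ltW B0) // lerDl.
  rewrite -[leLHS]mulr_natr /N mulnA natrM natrX -[(2 * 2)%N]/4%N /t.
  rewrite (_ : _ * _ = 1) //; field.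
  by apply/andP; split.
have [q1 Jq] := cayley_mean_ideal t N0 hJ Jb.
set q := cayley_mean b t N in q1 Jq.
exists (- q.2); first by rewrite -scaleN1r; exact: (idealZ hJ).
have -> : x - hract x (- q.2) = uract x q.
  rewrite /uract q1 scale1r; congr (_ + _).
  by apply/eqP; rewrite eq_sym -subr_eq0 opprK -ractDr subrr ractr0.
rewrite -(@ltr_pXn2r _ 4) ?nnegrE ?(ltW e0) //.
apply: le_lt_trans (norm_inner_cayley_mean b_sa (ltW t0) N0 small t0 erefl) _.
apply: le_lt_trans hk; rewrite le_eqVlt; apply/orP; left; apply/eqP.
rewrite -/b /t /N natrM natrX; field.
by apply/andP; split.
Qed.

(** Forward, [inner y] is continuous and [J] is closed. Backward, the case [y = z] puts [<z, z>] in
    [J], and then [z] is a limit of products [z a] with [a] in [J]. *)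
Lemma module_idealP (z : X) :
  module_ideal J z <-> forall y : X, J (inner y z).
Proof.
split=> [zJ y|h].
  apply: (closed_mem_norm (ideal_closed hJ)) => e e0.
  have C1 : 0 < 6 * `|y| + 1 by rewrite ltr_wpDl // mulr_ge0.
  have /closure_normP/(_ _ (divr_gt0 e0 C1)) := zJ.
  move=> [_ [r [x [a [Ja ->]]]]]; rewrite ltr_pdivlMr // => hz.
  exists (inner y (\sum_(i < r) hract (x i) (a i))).
    rewrite inner_sum; elim/big_rec: _ => [|i s _ Js]; first exact: ideal0.
    by apply: (idealD hJ) => //; rewrite inner_ract; exact: ideal_mull.
  rewrite -innerN -innerD; apply: le_lt_trans (norm_inner_le _ _) _.
  apply: le_lt_trans hz; rewrite mulrA mulrC ler_wpM2l //.
  by rewrite lerDl.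
apply/closure_normP => e e0; have [a Ja xa] := ideal_approx_unit (h z) e0.
exists (hract z a) => //; exists 1%N, (fun=> z), (fun=> a); split=> //.
by rewrite big_ord1.
Qed.

End ModuleIdeal.

(** * Boundedness of the left action *)

Lemma eq0_geometric (R : realType) (V : normedModType R[i]) (C : R[i]) (x : V) :
  0 <= C -> (forall k, `|x| <= C * 2^-1 ^+ k) -> x = 0.
Proof.
move=> C0 hx; apply/eqP; apply: contraT => x0.
have xgt0 : 0 < `|x| by rewrite normr_gt0.
have [k hk] := archi_complex C0 xgt0.
have : C / k.+1%:R < C / k.+1%:R.
  apply: lt_le_trans hk _; apply: le_trans (hx k.+1) _; rewrite ler_wpM2l //.
  rewrite exprVn lef_pV2 ?posrE ?exprn_gt0 ?ltr0n // -natrX ler_nat.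
  exact/ltnW/ltn_expl.
by rewrite ltxx.
Qed.

Section SelfAdjointRoot.
Variables (R : realType) (A : cstar_algebra R) (h : A).
Hypotheses (h_sa : astar h = h) (h_small : `|h| <= 4^-1).

(** A fixed point [s] satisfies [h^2 + (1 - s)^2 = 1], so [1 - s] acts as a square root of
    [1 - h^2], reached without functional calculus. *)
Let f (s : A) : A := (2^-1 : R[i]) *: (amul h h + amul s s).

Let norm_half : `|2^-1 : R[i]| = 2^-1.
Proof. by rewrite ger0_norm // invr_ge0. Qed.

Let amul_sqrB (s t : A) : amul s s - amul t t = amul s (s - t) + amul (s - t) t.
Proof.
have amulNr (a b : A) : amul a (- b) = - amul a b.
  by apply: (addrI (amul a b)); rewrite -amulDr !subrr amulr0.
have amulNl (a b : A) : amul (- a) b = - amul a b.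
  by apply: (addrI (amul a b)); rewrite -amulDl !subrr amul0r.
by rewrite amulDr amulDl amulNr amulNl addrA subrK.
Qed.

Let f_lip (s t : A) : `|f s - f t| <= 2^-1 * ((`|s| + `|t|) * `|s - t|).
Proof.
rewrite /f -scalerBr normrZ norm_half ler_wpM2l ?invr_ge0 //.
rewrite opprD addrACA subrr add0r amul_sqrB mulrDl.
apply: le_trans (ler_normD _ _) _; apply: lerD; first exact: norm_amul.
by rewrite [`|t| * _]mulrC; exact: norm_amul.
Qed.

Let u (k : nat) : A := iter k f 0.

Let u_small k : `|u k| <= 4^-1.
Proof.
elim: k => [|k IH]; first by rewrite normr0 invr_ge0.
rewrite /u iterS -/(u k) /f normrZ norm_half.
have sq (s : A) : `|s| <= 4^-1 -> `|amul s s| <= 4^-1.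
  move=> hs; apply: le_trans (norm_amul _ _) _.
  by rewrite -[4^-1]mulr1 ler_pM // (le_trans hs) // invf_le1 ?ltr0n ?ler1n.
rewrite ler_pdivrMl ?ltr0n //; apply: le_trans (ler_normD _ _) _.
by rewrite mulr2n mulrDl mul1r lerD ?sq.
Qed.

(** By [u_small] the norms of two iterates add up to at most 1, so [f_lip] at least halves the step
    each time. *)
Let u_step k : `|u k.+1 - u k| <= 2^-1 ^+ k.
Proof.
elim: k => [|k IH].
  rewrite expr0 subr0; apply: le_trans (u_small _) _.
  by rewrite invf_le1 ?ltr0n ?ler1n.
rewrite {1}/u iterS -/(u _) [X in _ - X]/u iterS -/(u _).
apply: le_trans (f_lip _ _) _; rewrite exprS ler_wpM2l ?invr_ge0 //.
apply: le_trans IH; rewrite ler_piMl //.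
apply: le_trans (lerD (u_small _) (u_small _)) _.
by rewrite -mulr2n -[4^-1 *+ 2]mulr_natr mulrC ler_pdivrMr ?ltr0n // mul1r ler_nat.
Qed.

(** The iterates start at 0 and inherit self-adjointness and commutation with [h]. Each relation
    passes to the limit because its defect is dominated by a geometric sequence. *)
Lemma root_of_small_selfadjoint : exists s : A,
  [/\ astar s = s, amul h s = amul s h & amul h h + amul s s = s + s].
Proof.
have [s hs] := cvg_geometric_steps u_step.
have u_sa k : astar (u k) = u k.
  elim: k => [|k IH]; first exact: astar0.
  rewrite /u iterS -/(u k) /f astarZ astarD !astarM IH h_sa.
  by rewrite (CrealP _) // realV realn.
have u_comm k : amul h (u k) = amul (u k) h.
  elim: k => [|k IH]; first by rewrite amul0r amulr0.
  rewrite /u iterS -/(u k) /f amulZl amulZr amulDl amulDr.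
  by congr (_ *: (_ + _)); [exact: amulA | rewrite amulA IH -!amulA IH].
exists s; split.
- apply/eqP; rewrite -subr_eq0; apply/eqP.
  apply: (@eq0_geometric _ _ 4) => // k.
  rewrite -(subrK (u k) (astar s)) -addrA; apply: le_trans (ler_normD _ _) _.
  rewrite -{1}u_sa -astarN -astarD norm_astar [`|u k - s|]distrC.
  apply: le_trans (lerD (hs k) (hs k)) _; rewrite le_eqVlt; apply/orP; left.
  by apply/eqP; ring.
- apply/eqP; rewrite -subr_eq0; apply/eqP.
  apply: (@eq0_geometric _ _ 4) => // k.
  have -> : amul h s - amul s h = amul h (s - u k) - amul (s - u k) h.
    have amulBr (a b c : A) : amul a (b - c) + amul a c = amul a b.
      by rewrite -amulDr subrK.
    have amulBl (a b c : A) : amul (a - b) c + amul b c = amul a c.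
      by rewrite -amulDl subrK.
    rewrite -(amulBr h s (u k)) -(amulBl s (u k) h) u_comm opprD addrACA.
    by rewrite subrr addr0.
  apply: le_trans (ler_normB _ _) _.
  apply: le_trans (lerD (norm_amul _ _) (norm_amul _ _)) _.
  have hh : `|h| * `|s - u k| <= 2 * 2^-1 ^+ k.
    apply: le_trans (hs k); rewrite ler_piMl //; apply: le_trans h_small _.
    by rewrite invf_le1 ?ltr0n ?ler1n.
  rewrite [`|s - u k| * _]mulrC; apply: le_trans (lerD hh hh) _.
  by rewrite le_eqVlt; apply/orP; left; apply/eqP; ring.
- have fs : f s - s = 0.
    apply: (@eq0_geometric _ _ 8) => // k.
    rewrite -(subrK (u k.+1) (f s)) -addrA; apply: le_trans (ler_normD _ _) _.
    (* The case [k = 0], where [u 0 = 0], gives this crude bound, which suffices for the Lipschitz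
       factor. *)
    have hs2 : `|s| <= 2 by have := hs 0%N; rewrite subr0 expr0 mulr1.
    rewrite [`|u _ - s|]distrC.
    apply: le_trans (lerD (_ : _ <= 4 * 2^-1 ^+ k) (_ : _ <= 4 * 2^-1 ^+ k)) _.
    + rewrite /u iterS -/(u k); apply: le_trans (f_lip _ _) _.
      rewrite ler_pdivrMl ?ltr0n //.
      rewrite (_ : 2 * _ = 4 * (2 * 2^-1 ^+ k)); last by ring.
      apply: ler_pM => //; rewrite (_ : 4 = 2 + 2); last by ring.
      apply: lerD => //; apply: le_trans (u_small k) _.
      by rewrite (le_trans (_ : _ <= 1)) ?invf_le1 ?ltr0n ?ler1n.
    + apply: le_trans (hs _) _; rewrite exprS mulrA mulfV ?pnatr_eq0 // mul1r.
      by rewrite ler_peMl ?exprn_ge0 ?invr_ge0 // ler1n.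
    + by rewrite le_eqVlt; apply/orP; left; apply/eqP; ring.
  have {3 4}<- : f s = s by apply/eqP; rewrite -subr_eq0 fs.
  rewrite /f -scalerDl (_ : 2^-1 + 2^-1 = 1) ?scale1r //.
  by field.
Qed.

End SelfAdjointRoot.

Lemma subr_mul_imaginary (U : nzRingType) (a b j : U) :
  a * b = b * a -> j * j = -1 -> GRing.comm j a -> GRing.comm j b ->
  (a - j * b) * (a + j * b) = a * a + b * b.
Proof.
move=> ab jj ja jb; rewrite mulrBl !mulrDr opprD addrA.
rewrite [a * (j * b)]mulrA -ja -[j * a * b]mulrA ab mulrA addrK.
by rewrite -mulrA [b * (j * b)]mulrA -jb -[j * b * b]mulrA [j * (j * _)]mulrA jj mulN1r opprK.
Qed.

Section LeftActionBound.
Variables (R : realType) (A : cstar_algebra R) (X : correspondence A).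
Local Notation U := (unitization A).
Implicit Types (x y : X) (h s : A) (u v : U).

Lemma inner_lact a x y : inner x (lact a y) = inner (lact (astar a) x) y.
Proof. by rewrite lact_adj astarK. Qed.

Lemma inner_nondegenerate x y : (forall z : X, inner z x = inner z y) -> x = y.
Proof.
move=> h; apply/eqP; rewrite -subr_eq0; apply/eqP/inner_eq0.
by rewrite innerD innerN h subrr.
Qed.

(** An operator with an adjoint is additive; the same argument gives homogeneity. *)
Lemma lactDr a x y : lact a (x + y) = lact a x + lact a y.
Proof. by apply: inner_nondegenerate => z; rewrite innerD !inner_lact innerD. Qed.

Lemma lactZr a (l : R[i]) x : lact a (l *: x) = l *: lact a x.
Proof. by apply: inner_nondegenerate => z; rewrite innerZ !inner_lact innerZ. Qed.

Lemma lact0l x : lact 0 x = 0.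
Proof. by rewrite -(scale0r (0 : A)) lactZ scale0r. Qed.

Definition ulact u x : X := u.1 *: x + lact u.2 x.

Lemma ulactDl u v x : ulact (u + v) x = ulact u x + ulact v x.
Proof. by rewrite /ulact /= scalerDl lactD addrACA. Qed.

Lemma ulactM u v x : ulact (u * v) x = ulact u (ulact v x).
Proof.
by rewrite /ulact /= !lactD !lactZ !lactDr !lactZr !scalerDr !scalerA lactM !addrA.
Qed.

Lemma ulact1 x : ulact 1 x = x.
Proof. by rewrite /ulact /= scale1r lact0l addr0. Qed.

Lemma ulact_in a x : ulact (uin a) x = lact a x.
Proof. by rewrite /ulact /= scale0r add0r. Qed.

Lemma inner_ulact u x y : inner (ulact u x) y = inner x (ulact (ustar u) y).
Proof. by rewrite /ulact innerDl innerD innerZl innerZ lact_adj. Qed.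

Lemma norm_ulact_isometry u x : ustar u * u = 1 -> `|ulact u x| = `|x|.
Proof.
move=> uu; apply/eqP; rewrite -(@eqrXn2 _ 2) // !hm_norm inner_ulact -ulactM.
by rewrite uu ulact1.
Qed.

(** The unitary [V] and its star act isometrically, and [2 h = V + V^*]. *)
Lemma norm_lact_small_selfadjoint h x : astar h = h -> `|h| <= 4^-1 ->
  `|lact h x| <= `|x|.
Proof.
move=> h_sa h_small; have [s [s_sa hs ss]] := root_of_small_selfadjoint h_sa h_small.
pose H : U := uin h; pose T : U := 1 - uin s.
have HT : H * T = T * H.
  by rewrite /T mulrBr mulrBl mulr1 mul1r /H -!uinM hs.
have HHTT : H * H + T * T = 1.
  have := congr1 (@uin R A) ss; rewrite !uinD !uinM -/H => E.
  rewrite /T mulrBr mulr1 mulrBl mul1r opprB !addrA [LHS](ACl (2*(1*4)*3*5)) /= E.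
  by rewrite addrA !addrK.
have T_sa : ustar T = T.
  by apply: (addIr (uin s)); rewrite -{1}s_sa -ustar_in -ustarD subrK ustar1.
clearbody T; pose I := uscal A 'i; pose V : U := H + I * T.
have II : I * I = -1.
  by rewrite /I -uscalM -expr2 sqrCi uscalN.
have Vstar : ustar V = H - I * T.
  rewrite /V ustarD ustarM T_sa ustar_in h_sa /I ustar_scal conjCi uscalN.
  by rewrite mulrN -uscal_comm.
have VV : ustar V * V = 1.
  by rewrite Vstar -HHTT /V; apply: subr_mul_imaginary => //; exact: uscal_comm.
(* The same identity with [- I] in place of [I] gives the other product. *)
have VV' : ustar (ustar V) * ustar V = 1.
  rewrite ustarK Vstar -HHTT /V.
  have -> : H - I * T = H + - I * T by rewrite mulNr.
  have -> : H + I * T = H - - I * T by rewrite mulNr opprK.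
  apply: subr_mul_imaginary => //; first by rewrite mulrNN.
    by apply/commr_sym/commrN/commr_sym/uscal_comm.
  by apply/commr_sym/commrN/commr_sym/uscal_comm.
have : `|lact h x + lact h x| <= `|x| + `|x|.
  rewrite -{1}(norm_ulact_isometry x VV) -(norm_ulact_isometry x VV').
  have -> : lact h x + lact h x = ulact V x + ulact (ustar V) x.
    by rewrite -ulactDl Vstar /V addrACA subrr addr0 ulactDl ulact_in.
  exact: ler_normD.
by rewrite -!mulr2n normrMn lerMn2r.
Qed.

Lemma norm_lact_selfadjoint_le h x : astar h = h -> `|lact h x| <= 4 * `|h| * `|x|.
Proof.
move=> h_sa; have [->|h0] := eqVneq h 0.
  by rewrite lact0l !normr0 mulr0 mul0r.
have h_gt0 : 0 < `|h| by rewrite normr_gt0.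
pose r : R[i] := (4 * `|h|)^-1.
have r0 : 0 < r by rewrite invr_gt0 mulr_gt0 // ltr0n.
have r_sa : astar (r *: h) = r *: h.
  by rewrite astarZ h_sa (CrealP (gtr0_real r0)).
have r_small : `|r *: h| <= 4^-1.
  by rewrite normrZ (gtr0_norm r0) /r invfM -mulrA mulVf ?mulr1 // gt_eqF.
have := norm_lact_small_selfadjoint x r_sa r_small.
by rewrite lactZ normrZ (gtr0_norm r0) /r ler_pdivrMl ?mulr_gt0 ?ltr0n.
Qed.

(** The equality [|a x|^2 = |<x, a^* a x>|] reduces to a self-adjoint element. The constants 6 of
    [norm_inner_le] and 4 of the self-adjoint case multiply to 24, below [5^2]. *)
Lemma norm_lact_le a x : `|lact a x| <= 5 * `|a| * `|x|.
Proof.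
rewrite -(@ler_pXn2r _ 2) ?nnegrE ?mulr_ge0 // hm_norm lact_adj -lactM.
apply: le_trans (norm_inner_le _ _) _.
have hn : `|lact (amul (astar a) a) x| <= 4 * `|a| ^+ 2 * `|x|.
  rewrite -norm_cstar; apply: norm_lact_selfadjoint_le.
  by rewrite astarM astarK.
apply: le_trans (_ : 6 * (`|x| * (4 * `|a| ^+ 2 * `|x|)) <= _).
  by rewrite ler_wpM2l // ler_wpM2l.
rewrite (_ : 6 * _ = 24 * (`|a| ^+ 2 * `|x| ^+ 2)); last by ring.
rewrite (_ : (5 * `|a| * `|x|) ^+ 2 = 25 * (`|a| ^+ 2 * `|x| ^+ 2)); last by ring.
by rewrite ler_wpM2r ?ler_nat // mulr_ge0 // exprn_ge0.
Qed.

End LeftActionBound.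

(** * Ideals and their preimages (X^m)^{-1}(J) *)

Section Ideals.
Variables (R : realType) (A : cstar_algebra R).

Lemma is_ideal_bigcap (T : Type) (D : set T) (J : T -> set A) :
  (forall i, D i -> is_ideal (J i)) -> is_ideal (\bigcap_(i in D) J i).
Proof.
move=> hJ; split.
- by move=> i Di; exact: (ideal0 (hJ i Di)).
- by move=> a b Ja Jb i Di; apply: (idealD (hJ i Di)); [exact: Ja | exact: Jb].
- by move=> l a Ja i Di; apply: (idealZ (hJ i Di)); exact: Ja.
- by move=> a b Jb i Di; apply: (ideal_mull (hJ i Di)); exact: Jb.
- by move=> a b Ja i Di; apply: (ideal_mulr (hJ i Di)); exact: Ja.
- by apply: closed_bigI => i Di; exact: (ideal_closed (hJ i Di)).
Qed.

Lemma bigcap_pairE (I J : set A) :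
  I `&` J = \bigcap_(b in [set: bool]) (if b then I else J).
Proof.
apply/seteqP; split=> [a [Ia Ja] [] _ //|a h].
by split; [exact: (h true) | exact: (h false)].
Qed.

Lemma is_ideal_setI (I J : set A) : is_ideal I -> is_ideal J -> is_ideal (I `&` J).
Proof.
by move=> hI hJ; rewrite bigcap_pairE; apply: is_ideal_bigcap => -[].
Qed.

Lemma closed_inner_preimage (X : hilbert_module A) (J : set A) (y : X) : closed J ->
  closed [set x : X | J (inner y x)].
Proof.
apply: (closed_bounded_preimage (f := inner y) (C := 6 * `|y|)) => [u v|].
  by rewrite -innerN -innerD -mulrA norm_inner_le.
by rewrite mulr_ge0.
Qed.

Lemma closed_inner_preimagel (X : hilbert_module A) (J : set A) (y : X) : closed J ->
  closed [set x : X | J (inner x y)].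
Proof.
apply: (closed_bounded_preimage (f := fun x => inner x y) (C := 6 * `|y|)) => [u v|].
  rewrite -(inner_star y u) -(inner_star y v) -astarN -astarD norm_astar.
  by rewrite -innerN -innerD -mulrA norm_inner_le.
by rewrite mulr_ge0.
Qed.

End Ideals.

Section InverseIdeal.
Variables (R : realType) (n : nat) (A : cstar_algebra R) (X : product_system n A).
Implicit Types (m k : {ffun 'I_n -> nat}) (J : set A).

Lemma inv_ideal_in0 J : inv_ideal X 0 J = J.
Proof. by rewrite /inv_ideal eqxx. Qed.

Lemma inv_idealP m J a : m != 0 -> is_ideal J ->
  inv_ideal X m J a <-> forall x y : X m, J (inner y (lact a x)).
Proof.
move=> m0 hJ; rewrite /inv_ideal (negbTE m0) /=; split=> h x.
  exact/module_idealP.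
by apply/module_idealP => // y; exact: h.
Qed.

Lemma is_ideal_inv m J : is_ideal J -> is_ideal (inv_ideal X m J).
Proof.
move=> hJ; have [->|m0] := eqVneq m 0; first by rewrite inv_ideal_in0.
split.
- by apply/inv_idealP => // x y; rewrite lact0l inner0r; exact: ideal0.
- move=> a b /inv_idealP-/(_ m0 hJ) ha /inv_idealP-/(_ m0 hJ) hb.
  by apply/inv_idealP => // x y; rewrite lactD innerD; exact: (idealD hJ).
- move=> l a /inv_idealP-/(_ m0 hJ) ha.
  by apply/inv_idealP => // x y; rewrite lactZ innerZ; exact: (idealZ hJ).
- move=> a b /inv_idealP-/(_ m0 hJ) hb.
  by apply/inv_idealP => // x y; rewrite lactM inner_lact; exact: hb.
- move=> a b /inv_idealP-/(_ m0 hJ) ha.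
  by apply/inv_idealP => // x y; rewrite lactM; exact: ha.
- apply: closed_normP => a ha; apply/inv_idealP => // x y.
  (* For fixed [x] and [y] this set is the preimage of [J] under the composite of the bounded maps
     [b |-> b x] and [z |-> <y, z>]. *)
  suff : closed [set b | J (inner y (lact b x))].
    move=> /closed_mem_norm; apply => e /ha[b /inv_idealP-/(_ m0 hJ) hb ab].
    by exists b.
  have cJ : closed [set z : X m | J (inner y z)].
    exact: (closed_inner_preimage (ideal_closed hJ)).
  apply: (closed_bounded_preimage (f := fun b => lact b x) (C := 5 * `|x|)) cJ.
    move=> b c; rewrite -scaleN1r -lactZ scaleN1r -lactD mulrAC.
    exact: norm_lact_le.
  by rewrite mulr_ge0.
Qed.

Lemma inv_ideal_bigcap m (T : Type) (D : set T) (J : T -> set A) :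
  (forall i, D i -> is_ideal (J i)) ->
  inv_ideal X m (\bigcap_(i in D) J i) = \bigcap_(i in D) inv_ideal X m (J i).
Proof.
move=> hJ; have [->|m0] := eqVneq m 0.
  by rewrite inv_ideal_in0; apply: eq_bigcapr => i _; rewrite inv_ideal_in0.
have hcap := is_ideal_bigcap hJ.
apply/seteqP; split=> [a /inv_idealP-/(_ m0 hcap) ha i Di|a ha].
  by apply/(inv_idealP _ m0 (hJ i Di)) => x y; exact: ha.
apply/inv_idealP => // x y i Di.
by have /inv_idealP-/(_ m0 (hJ i Di)) := ha i Di; exact.
Qed.

Lemma inv_idealI m I J : is_ideal I -> is_ideal J ->
  inv_ideal X m (I `&` J) = inv_ideal X m I `&` inv_ideal X m J.
Proof.
move=> hI hJ; rewrite !bigcap_pairE inv_ideal_bigcap; last by case.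
by apply: eq_bigcapr => -[].
Qed.

Lemma sub_inv_ideal m I J : is_ideal I -> is_ideal J -> I `<=` J ->
  inv_ideal X m I `<=` inv_ideal X m J.
Proof.
by move=> hI hJ /setIidPl <-; rewrite inv_idealI //; exact: subIsetr.
Qed.

Lemma ffun_add_neq0 m k : m != 0 -> m + k != 0.
Proof.
apply: contraNneq => h; apply/eqP/ffunP => i.
have := congr1 (fun f : {ffun 'I_n -> nat} => f i) h; rewrite !ffunE => /eqP.
by rewrite addn_eq0 => /andP[/eqP].
Qed.

(** By [tens_inner] the second condition is the first one for elementary tensors. As [J] is closed,
    density extends it to all vectors, one argument of the inner product at a time. *)
Lemma inv_ideal_tensor m k J (a : A) : m != 0 -> k != 0 -> is_ideal J ->
  (forall w w' : ps_tens X m k, J (inner w' (lact a w))) <->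
  (forall (x y : X m) (x' y' : X k), J (inner y' (lact (inner y (lact a x)) x'))).
Proof.
move=> m0 k0 hJ; split=> [h x y x' y'|h].
  by rewrite -(tens_inner (ps_tens X m k)) -tens_lact; exact: h.
have cJ := ideal_closed hJ.
have memJ r (f : 'I_r -> A) : (forall i, J (f i)) -> J (\sum_(i < r) f i).
  move=> hf; elim/big_rec: _ => [|i s _]; first exact: ideal0.
  exact: (idealD hJ).
have elem_r (x : X m) (x' : X k) (w' : ps_tens X m k) :
    J (inner w' (lact a (tens (ps_tens X m k) x x'))).
  have : closure [set z | exists r (x : 'I_r -> X m) (y : 'I_r -> X k),
      z = \sum_(i < r) tens (ps_tens X m k) (x i) (y i)] w'.
    by rewrite tens_dense.
  set v := lact a _ => /closure_normP hw'.
  apply: (closed_mem_norm (closed_inner_preimagel (y := v) cJ)) => e /hw'.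
  move=> [_ [r [y [y' ->]]] hy].
  exists (\sum_(i < r) tens (ps_tens X m k) (y i) (y' i)) => //=.
  by rewrite inner_suml; apply: memJ => i; rewrite /v tens_lact tens_inner; exact: h.
(* Moving [a] to the other side frees [w], which can then be approximated in turn. *)
move=> w w'; rewrite inner_lact; set v := lact _ _.
have : closure [set z | exists r (x : 'I_r -> X m) (y : 'I_r -> X k),
    z = \sum_(i < r) tens (ps_tens X m k) (x i) (y i)] w.
  by rewrite tens_dense.
move=> /closure_normP hw.
apply: (closed_mem_norm (closed_inner_preimage (y := v) cJ)) => e /hw.
move=> [_ [r [x [x' ->]]] hx].
exists (\sum_(i < r) tens (ps_tens X m k) (x i) (x' i)) => //=.
by rewrite inner_sum; apply: memJ => i; rewrite /v -inner_lact; exact: elem_r.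
Qed.

(** Through the isomorphism, inner products in the fiber at [m + k] become those of the tensor
    product, where [inv_ideal_tensor] separates the exponents. A zero exponent is covered by the
    convention for [X^0]. *)
Lemma inv_idealD m k J : is_ideal J ->
  inv_ideal X (m + k) J = inv_ideal X m (inv_ideal X k J).
Proof.
move=> hJ; have [->|m0] := eqVneq m 0; first by rewrite add0r inv_ideal_in0.
have [->|k0] := eqVneq k 0; first by rewrite addr0 inv_ideal_in0.
have mk0 := ffun_add_neq0 k m0; have hkJ := is_ideal_inv k hJ.
have [phiV phiK phiVK] := iso_bij (ps_iso X m0 k0).
apply/seteqP; split=> a /inv_idealP.
  move=> /(_ mk0 hJ) ha; apply/inv_idealP => // x y; apply/inv_idealP => // x' y'.
  apply: (inv_ideal_tensor a m0 k0 hJ).1 => w w'.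
  by rewrite -(iso_inner (ps_iso X m0 k0)) iso_lact; exact: ha.
move=> /(_ m0 hkJ) ha; apply/inv_idealP => // z z'.
rewrite -(phiVK z) -(phiVK z') -iso_lact iso_inner.
apply: (inv_ideal_tensor a m0 k0 hJ).2 => x y x' y'.
by have /inv_idealP-/(_ k0 hJ) := ha x y; exact.
Qed.

End InverseIdeal.

(** * Characteristic vectors and induction on finite sets *)

Section CharacteristicVectors.
Variable n : nat.
Implicit Types (F H : {set 'I_n}) (i : 'I_n).

Lemma char_vec_set0 : char_vec (@finset.set0 'I_n) = 0.
Proof. by apply/ffunP => j; rewrite !ffunE finset.in_set0. Qed.

Lemma char_vec_setU1 i H : i \notin H ->
  char_vec (i |: H)%SET = char_vec [set i]%SET + char_vec H.
Proof.
move=> iH; apply/ffunP => j; rewrite !ffunE in_setU1 finset.in_set1.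
by case: eqP => [->|//]; rewrite (negbTE iH).
Qed.

Lemma cochar_vecE F : cochar_vec F = char_vec (~: F)%SET.
Proof.
by apply/ffunP => j; rewrite !ffunE finset.in_setT finset.in_setC; case: (j \in F).
Qed.

Lemma subset_setCU1 F i H :
  (F \subset (~: (i |: H))%SET) = (i \notin F) && (F \subset (~: H)%SET).
Proof.
rewrite finset.setCU finset.subsetI (finset.subsetC F [set i]%SET).
by rewrite finset.sub1set finset.in_setC.
Qed.

Lemma finset_ind (P : {set 'I_n} -> Prop) : P finset.set0 ->
  (forall i H, i \notin H -> P H -> P (i |: H)%SET) -> forall H, P H.
Proof.
move=> P0 PU H; have [k] := ubnP #|H|; elim: k H => // k IH H.
have [->//|[i iH]] := set_0Vmem H; rewrite ltnS => hk.
rewrite -(finset.setD1K iH); apply: PU; first by rewrite !inE eqxx.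
by apply: IH; apply: leq_trans hk; rewrite [X in (_ < X)%N](cardsD1 i) iH.
Qed.

End CharacteristicVectors.

(** * The two maps between invariant families and T-families *)

Section Correspondence.
Variables (R : realType) (n : nat) (A : cstar_algebra R) (X : product_system n A).
Implicit Types (F G H : {set 'I_n}) (i : 'I_n) (J : set A) (K I : ideal_family n A).
Local Notation P H := (inv_ideal X (char_vec H)).

Lemma inv_ideal_setU1 i H J : i \notin H -> is_ideal J ->
  P (i |: H)%SET J = P [set i]%SET (P H J).
Proof. by move=> iH hJ; rewrite char_vec_setU1 // inv_idealD. Qed.

(** Addition of exponents is commutative, so [i] may also be split off on the inner side. *)
Lemma inv_ideal_setU1C i H J : i \notin H -> is_ideal J ->
  P (i |: H)%SET J = P H (P [set i]%SET J).
Proof. by move=> iH hJ; rewrite char_vec_setU1 // addrC inv_idealD. Qed.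

Section InvariantToT.
Variable K : ideal_family n A.
Hypothesis hK : invariant_family X K.
Let K_ideal F : is_ideal (K F). Proof. exact: hK.1. Qed.

(** Induction on [H]. The sets allowed for [H] fall into pairs [G], [i |: G] with [i] outside [G];
    the invariance equation sends the intersection over each pair to [K G], so exactly the sets
    avoiding [i] survive. *)
Lemma inv_ideal_bigcap_invariant F H : F \subset (~: H)%SET ->
  P H (T_of_invariant K F) =
  \bigcap_(G in [set G : {set 'I_n} | F \subset G /\ G \subset (~: H)%SET]) K G.
Proof.
have capK (D : set {set 'I_n}) : is_ideal (\bigcap_(G in D) K G).
  exact: is_ideal_bigcap.
have hT : is_ideal (T_of_invariant K F) by exact: capK.
elim/finset_ind: H => [|i H iH IH].
  rewrite char_vec_set0 inv_ideal_in0 finset.setC0 => _.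
  apply/seteqP; split=> a ha G /=; first by move=> [FG _]; exact: ha.
  by move=> FG; apply: ha; split=> //; exact: finset.subsetT.
rewrite subset_setCU1 => /andP[iF FH]; rewrite inv_ideal_setU1 // IH //.
set D := [set G : {set 'I_n} | _ /\ G \subset (~: (i |: H))%SET].
have DE G : D G <-> [/\ F \subset G, i \notin G & G \subset (~: H)%SET].
  rewrite /D /= subset_setCU1.
  by split=> [[FG /andP[iG GH]]|[FG iG GH]]; split=> //; apply/andP.
have -> : \bigcap_(G in [set G : {set 'I_n} | F \subset G /\ G \subset (~: H)%SET]) K G
    = \bigcap_(G in D) (K G `&` K (i |: G)%SET).
  apply/seteqP; split=> a ha G.
    move=> /DE[FG iG GH]; split; apply: ha => /=; first by split.
    split; first exact: fintype.subset_trans FG (finset.subsetUr _ _).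
    by rewrite finset.subUset GH finset.sub1set !inE iH.
  (* A set [G] that contains [i] is the second member of the pair of [G :\ i]. *)
  move=> [FG GH]; have [iG|iG] := boolP (i \in G); last first.
    by have [] : (K G `&` K (i |: G)%SET) a by apply: ha; apply/DE.
  rewrite -(finset.setD1K iG).
  have [] // : (K (G :\ i)%SET `&` K (i |: (G :\ i))%SET) a.
  apply: ha; apply/DE; split; first by rewrite finset.subsetD1 FG iF.
    by rewrite !inE eqxx.
  exact: fintype.subset_trans (finset.subsetDl _ _) GH.
rewrite inv_ideal_bigcap; last by move=> G _; exact: is_ideal_setI.
by apply: eq_bigcapr => G /DE[_ iG _]; rewrite -hK.2.
Qed.

(** The sets containing [F] are those that also avoid [i], which give the first factor, and those
    that contain [i |: F]. *)
Lemma T_family_of_invariant : T_family X (T_of_invariant K).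
Proof.
split=> [F|F i iF]; first exact: is_ideal_bigcap.
have setC1E G : (G \subset (~: [set i])%SET) = (i \notin G).
  by rewrite finset.subsetC finset.sub1set finset.in_setC.
rewrite inv_ideal_bigcap_invariant ?setC1E //.
apply/seteqP; split=> a.
  move=> ha; split=> G /=; first by move=> [FG _]; exact: ha.
  by move=> iFG; apply: ha => /=; exact: fintype.subset_trans (finset.subsetUr _ _) iFG.
move=> [h1 h2] G /= FG; have [iG|iG] := boolP (i \in G).
  by apply: h2 => /=; rewrite finset.subUset finset.sub1set iG.
by apply: h1 => /=; rewrite setC1E.
Qed.

Lemma T_of_invariantK : invariant_of_T X (T_of_invariant K) = K.
Proof.
apply/funext => F; rewrite /invariant_of_T cochar_vecE.
rewrite inv_ideal_bigcap_invariant finset.setCK //.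
apply/seteqP; split=> [a|a Ka G /= [FG GF]]; first exact.
by have -> : G = F by apply/eqP; rewrite finset.eqEsubset GF.
Qed.

End InvariantToT.

Section TToInvariant.
Variable I : ideal_family n A.
Hypothesis hI : T_family X I.
Let I_ideal F : is_ideal (I F). Proof. exact: hI.1. Qed.
Let P_ideal H J : is_ideal J -> is_ideal (P H J). Proof. exact: is_ideal_inv. Qed.

(** Let [C] be the complement of [i |: G], so that the complement of [G] is [i |: C]. The term for
    [G] is [P C (P [set i] (I G))]; by the T-equation it meets [P C (I (i |: G))] in [P C (I G)],
    and applying [P [set i]] restores the term for [G]. *)
Lemma invariant_family_of_T : invariant_family X (invariant_of_T X I).
Proof.
split=> [F|G i iG]; first exact: is_ideal_inv.
rewrite /invariant_of_T !cochar_vecE.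
have iC : i \notin (~: (i |: G))%SET by rewrite !inE eqxx.
have -> : (~: G = i |: ~: (i |: G))%SET.
  by apply/setP => j; rewrite !inE; case: eqP => //= ->; rewrite iG.
rewrite {2}inv_ideal_setU1C // -inv_idealI //; last exact: P_ideal.
by rewrite -hI.2 // inv_ideal_setU1.
Qed.

(** The second factor of the T-equation, used one point at a time. *)
Lemma T_family_sub F G : F \subset G -> I F `<=` I G.
Proof.
move=> FG; rewrite -(finset.setUidPr FG); move: {FG}G.
elim/finset_ind => [|i G iG IH]; first by rewrite finset.setU0.
apply: subset_trans IH _; rewrite finset.setUCA.
have [iFG|iFG] := boolP (i \in (F :|: G)%SET).
  suff -> : (i |: (F :|: G) = F :|: G)%SET by [].
  by apply/finset.setUidPr; rewrite finset.sub1set.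
by rewrite {1}(hI.2 _ _ iFG); exact: subIsetr.
Qed.

(** The first factor of the T-equation settles a single point, and monotonicity of preimages
    iterates it. *)
Lemma T_family_sub_inv F H : F \subset (~: H)%SET -> I F `<=` P H (I F).
Proof.
elim/finset_ind: H => [|i H iH IH].
  by rewrite char_vec_set0 inv_ideal_in0 => _ a.
rewrite subset_setCU1 => /andP[iF FH]; apply: subset_trans (IH FH) _.
rewrite inv_ideal_setU1C //; apply: (sub_inv_ideal (I_ideal F) (P_ideal _ (I_ideal F))).
by rewrite {1}(hI.2 _ _ iF); exact: subIsetl.
Qed.

Lemma invariant_of_TK : T_of_invariant (invariant_of_T X I) = I.
Proof.
apply/funext => F; apply/seteqP; split=> [a|a IFa G /= FG]; last first.
  rewrite /invariant_of_T cochar_vecE.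
  by apply: T_family_sub_inv; [rewrite finset.setCK | exact: (T_family_sub FG)].
(* Induction on the number of points outside [F], so that larger sets are settled first. *)
have [k] := ubnP #|(~: F)%SET|; elim: k F => // k IH F; rewrite ltnS => hk ha.
have up i : i \notin F -> I (i |: F)%SET a.
  move=> iF; apply: IH.
    apply: leq_trans hk; rewrite [X in (_ < X)%N](cardsD1 i) finset.in_setC iF add1n ltnS.
    apply: fintype.subset_leq_card; apply/fintype.subsetP => j; rewrite !inE negb_or.
    by [].
  by move=> G /= iFG; apply: ha; exact: fintype.subset_trans (finset.subsetUr _ _) iFG.
(* When [i] is removed from [H], the factor [I (i |: F)] of the T-equation is supplied by [up]. *)
have peel H : F \subset (~: H)%SET -> P H (I F) a -> I F a.
  elim/finset_ind: H => [|i H iH IHH]; first by rewrite char_vec_set0 inv_ideal_in0.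
  rewrite subset_setCU1 => /andP[iF FH]; rewrite inv_ideal_setU1C // => Pa.
  apply: IHH => //; rewrite (hI.2 _ _ iF) inv_idealI //; last exact: P_ideal.
  split=> //; apply: T_family_sub_inv (up _ iF).
  by rewrite finset.subUset FH finset.sub1set !inE iH.
apply: (peel (~: F)%SET); first by rewrite finset.setCK.
by have := ha F (fintype.subxx _); rewrite /invariant_of_T cochar_vecE.
Qed.

End TToInvariant.

End Correspondence.

(** * Lattice structure and order isomorphisms *)

Section Lattices.
Variables (R : realType) (n : nat) (A : cstar_algebra R).
Implicit Types (S T : set (ideal_family n A)) (f g : ideal_family n A -> ideal_family n A).

(** The join is the intersection of all common upper bounds in [S]; as [D] may be empty, no upper
    bound has to be exhibited. *)
Lemma is_lattice_bigcap S :
  (forall D : set (ideal_family n A), D `<=` S ->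
     S (fun F => \bigcap_(K in D) K F)) ->
  is_lattice S.
Proof.
move=> capS K1 K2 S1 S2; split.
  exists (fun F => \bigcap_(K in [set K1; K2]) K F); split.
  - by apply: capS => K [] ->.
  - by move=> F a; apply; left.
  - by move=> F a; apply; right.
  - by move=> L _ L1 L2 F a La K [] ->; [exact: L1 | exact: L2].
exists (fun F => \bigcap_(K in [set L | [/\ S L, fam_le K1 L & fam_le K2 L]]) K F).
split.
- by apply: capS => K [].
- by move=> F a Ka L [_ + _]; apply.
- by move=> F a Ka L [_ _]; apply.
- by move=> L SL L1 L2 F a; apply.
Qed.

(** A competing bound [L] in [T] is moved to [S] by [g], compared there, and moved back by [f]. *)
Lemma lattice_morphism_of_order_iso S T f g :
  (forall K, S K -> T (f K)) -> (forall I, T I -> S (g I)) ->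
  (forall K1 K2, S K1 -> S K2 -> fam_le K1 K2 -> fam_le (f K1) (f K2)) ->
  (forall I1 I2, T I1 -> T I2 -> fam_le I1 I2 -> fam_le (g I1) (g I2)) ->
  (forall K, S K -> g (f K) = K) -> (forall I, T I -> f (g I) = I) ->
  lattice_morphism S T f.
Proof.
move=> fT gS f_le g_le gf fg; split=> // K1 K2 M S1 S2 [SM M1 M2 Mu]; split.
- exact: fT.
- exact: f_le.
- exact: f_le.
- move=> L TL L1 L2; rewrite -(fg _ TL); apply: f_le; [exact: gS | by [] |].
  have := g_le _ _ TL (fT _ S1) L1; have := g_le _ _ TL (fT _ S2) L2.
  by rewrite !gf // => h2 h1; apply: Mu => //; exact: gS.
- exact: fT.
- exact: f_le.
- exact: f_le.
- move=> L TL L1 L2; rewrite -(fg _ TL); apply: f_le; [by [] | exact: gS |].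
  have := g_le _ _ (fT _ S1) TL L1; have := g_le _ _ (fT _ S2) TL L2.
  by rewrite !gf // => h2 h1; apply: Mu => //; exact: gS.
Qed.

End Lattices.

Section FamilyLattices.
Variables (R : realType) (n : nat) (A : cstar_algebra R) (X : product_system n A).

(** The defining equation survives intersections because preimages commute with them; the same
    reason serves for T-families. *)
Lemma is_lattice_invariant_family : is_lattice (invariant_family X).
Proof.
apply: is_lattice_bigcap => D hD; split=> [F|G i iG].
  by apply: is_ideal_bigcap => K /hD[hK _].
rewrite -bigcapI inv_ideal_bigcap; last by move=> K /hD[hK _]; exact: is_ideal_setI.
by apply: eq_bigcapr => K /hD[_]; exact.
Qed.

Lemma is_lattice_T_family : is_lattice (T_family X).
Proof.
apply: is_lattice_bigcap => D hD; split=> [F|F i iF].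
  by apply: is_ideal_bigcap => I /hD[hI _].
rewrite inv_ideal_bigcap; last by move=> I /hD[].
by rewrite -bigcapI; apply: eq_bigcapr => I /hD[_]; exact.
Qed.

End FamilyLattices.

Theorem proposition4p4 (R : realType) (n : nat) (A : cstar_algebra R)
    (X : product_system n A) (hX : is_proper X) :
  lattice_isomorphisms (invariant_family X) (T_family X)
    (@T_of_invariant R n A) (invariant_of_T X).
Proof.
have T_le (K1 K2 : ideal_family n A) : fam_le K1 K2 ->
    fam_le (T_of_invariant K1) (T_of_invariant K2).
  by move=> K12 F a ha G FG; apply/K12/ha.
have inv_le (I1 I2 : ideal_family n A) : T_family X I1 -> T_family X I2 ->
    fam_le I1 I2 -> fam_le (invariant_of_T X I1) (invariant_of_T X I2).
  by move=> [h1 _] [h2 _] I12 F; apply: sub_inv_ideal.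
have toT (K : ideal_family n A) : invariant_family X K -> T_family X (T_of_invariant K).
  exact: T_family_of_invariant.
have toK (I : ideal_family n A) : T_family X I -> invariant_family X (invariant_of_T X I).
  exact: invariant_family_of_T.
split.
- exact: is_lattice_invariant_family.
- exact: is_lattice_T_family.
- apply: (lattice_morphism_of_order_iso (g := invariant_of_T X)) => //.
  + by move=> K1 K2 _ _; exact: T_le.
  + by move=> K hK; exact: T_of_invariantK.
  + by move=> I hI; exact: invariant_of_TK.
- apply: (lattice_morphism_of_order_iso (g := @T_of_invariant R n A)) => //.
  + by move=> K1 K2 _ _; exact: T_le.
  + by move=> I hI; exact: invariant_of_TK.
  + by move=> K hK; exact: T_of_invariantK.
- by move=> K hK; exact: T_of_invariantK.
- by move=> I hI; exact: invariant_of_TK.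
Qed.
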